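(* Let $b$, $d$, $t_0,t_1,\dots,t_n$, $u_1,\dots,u_n$ be indeterminates and let $M$ be a nonnegative integer. Then, as an identity of rational functions, \begin{gather*} \sum_{\substack{k_1,\dots,k_n\ge 0\\ |\mathbf k|\le M}} \prod_{i,j=1}^n\frac{(qu_i/t_iu_j;q)_{k_i}}{(qu_i/u_j;q)_{k_i}} \prod_{1\le i<j\le n}\frac{(t_ju_i/u_j;q)_{k_i-k_j}}{(qu_i/t_iu_j;q)_{k_i-k_j}} \prod_{1\le i<j\le n}\frac{1}{u_i-u_j}\\ \times\det_{1\le i,j\le n}\left[(u_iq^{k_i})^{n-j}\left(1-t_i^{j-n-1}\frac{1-t_0u_iq^{k_i}}{1-t_0u_iq^{k_i}/t_i}\prod_{s=1}^n\frac{u_iq^{k_i}-u_s}{u_iq^{k_i}/t_i-u_s}\right)\right]\\ \times\frac{(d,q^{-M};q)_{|\mathbf k|}}{(bdq^{-M}/t_0,\ t_0q/(bt_1\cdots t_n);q)_{|\mathbf k|}} \prod_{i=1}^n\frac{(t_0u_iq/t_i,\ bu_i,\ t_0^2u_iq^{1+M}/(bdt_1\cdots t_n);q)_{k_i}}{(t_0u_iq,\ t_0u_iq/(dt_i),\ t_0u_iq^{1+M}/t_i;q)_{k_i}}\\ \times\prod_{i=1}^n\frac{(dq^{-M}/(t_0u_i);q)_{|\mathbf k|-k_i}}{(dt_iq^{-M}/(t_0u_i);q)_{|\mathbf k|-k_i}} \cdot q^{|\mathbf k|+\sum_{i=1}^n(1-i)k_i}\prod_{i=1}^n t_i^{(i-1)k_i+\sum_{j=i+1}^nk_j}\\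 =\frac{(t_0q/b,\ t_0q/(bdt_1\cdots t_n);q)_M}{(t_0q/(bd),\ t_0q/(bt_1\cdots t_n);q)_M}\prod_{i=1}^n\frac{(t_0u_iq/t_i,\ t_0u_iq/d;q)_M}{(t_0u_iq,\ t_0u_iq/(dt_i);q)_M}. \end{gather*}
   Context: $q$ is an indeterminate. For an integer $k$, the $q$-shifted factorial is $(a;q)_k=\prod_{j=0}^{k-1}(1-aq^j)$ if $k\ge0$ and $(a;q)_k=1/\prod_{j=1}^{-k}(1-aq^{-j})$ if $k<0$ (equivalently $(a;q)_k=(a;q)_\infty/(aq^k;q)_\infty$). Condensed notation: $(a_1,\dots,a_m;q)_k=(a_1;q)_k\cdots(a_m;q)_k$. For $\mathbf k=(k_1,\dots,k_n)$, $|\mathbf k|=k_1+\dots+k_n$. *)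

(* Defs.v *)
From HB Require Import structures.
From mathcomp Require Import all_boot all_order all_algebra.
From mathcomp Require Import fraction.
From mathcomp Require Import mpoly.
Set Implicit Arguments. Unset Strict Implicit. Unset Printing Implicit Defensive.
Import Order.TTheory GRing.Theory Num.Theory.
Local Open Scope ring_scope.

Section QSum.
Variable F : fieldType.

Definition qpoch (a q : F) (k : int) : F :=
  match k with
  | Posz m => \prod_(j < m) (1 - a * q ^+ j)
  | Negz m => (\prod_(j < m.+1) (1 - a * q ^- j.+1))^-1
  end.

Variables (n M : nat) (q b d t0 : F) (t u : 'I_n -> F).
(* Indices are 0-based: t i, u i for i : 'I_n stand for t_{i+1}, u_{i+1}. *)

Definition tprod : F := \prod_(i < n) t i.

Definition absk (k : 'I_n -> nat) : nat := \sum_(i < n) k i.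

Definition det_entry (k : 'I_n -> nat) (i j : 'I_n) : F :=
  let x := u i * q ^+ k i in
  x ^+ (n - j.+1) *
  (1 - t i ^- (n - j) *
       ((1 - t0 * x) / (1 - t0 * x / t i)) *
       \prod_(s < n) ((x - u s) / (x / t i - u s))).

Definition summand (k : 'I_n -> nat) : F :=
  let K := absk k in
  (\prod_(i < n) \prod_(j < n)
      (qpoch (q * u i / (t i * u j)) q (k i) / qpoch (q * u i / u j) q (k i)))
  * (\prod_(i < n) \prod_(j < n | (i < j)%N)
      (qpoch (t j * u i / u j) q ((k i)%:Z - (k j)%:Z)
       / qpoch (q * u i / (t i * u j)) q ((k i)%:Z - (k j)%:Z)))
  * (\prod_(i < n) \prod_(j < n | (i < j)%N) (u i - u j)^-1)
  * \det (\matrix_(i < n, j < n) det_entry k i j)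
  * (qpoch d q K * qpoch (q ^- M) q K
     / (qpoch (b * d * q ^- M / t0) q K * qpoch (t0 * q / (b * tprod)) q K))
  * (\prod_(i < n)
      (qpoch (t0 * u i * q / t i) q (k i) * qpoch (b * u i) q (k i)
       * qpoch (t0 ^+ 2 * u i * q ^+ M.+1 / (b * d * tprod)) q (k i)
       / (qpoch (t0 * u i * q) q (k i) * qpoch (t0 * u i * q / (d * t i)) q (k i)
          * qpoch (t0 * u i * q ^+ M.+1 / t i) q (k i))))
  * (\prod_(i < n)
      (qpoch (d * q ^- M / (t0 * u i)) q (K - k i)%N
       / qpoch (d * t i * q ^- M / (t0 * u i)) q (K - k i)%N))
  (* q^{|k| + sum_i (1-i) k_i} with 1-based i, i.e. q^{|k| - sum_{i0} i0 k_{i0}} *)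
  * (q ^+ K / q ^+ (\sum_(i < n) i * k i)%N)
  * \prod_(i < n) t i ^+ (i * k i + \sum_(j < n | (i < j)%N) k j)%N.

Definition lhs : F :=
  \sum_(k : {ffun 'I_n -> 'I_M.+1} | (absk (fun i => nat_of_ord (k i)) <= M)%N)
     summand (fun i => nat_of_ord (k i)).

Definition rhs : F :=
  qpoch (t0 * q / b) q M * qpoch (t0 * q / (b * d * tprod)) q M
  / (qpoch (t0 * q / (b * d)) q M * qpoch (t0 * q / (b * tprod)) q M)
  * \prod_(i < n)
      (qpoch (t0 * u i * q / t i) q M * qpoch (t0 * u i * q / d) q M
       / (qpoch (t0 * u i * q) q M * qpoch (t0 * u i * q / (d * t i)) q M)).

End QSum.

Definition nvars (n : nat) : nat := (n + n + 3).+1.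
Definition RatFun (n : nat) : fieldType := {fraction {mpoly rat[nvars n]}}.

Definition indet (n : nat) (m : nat) : RatFun n :=
  tofrac ('X_(inord m) : {mpoly rat[nvars n]}).

Definition Xq n : RatFun n := indet n 0.
Definition Xb n : RatFun n := indet n 1.
Definition Xd n : RatFun n := indet n 2.
Definition Xt0 n : RatFun n := indet n 3.
Definition Xt n (i : 'I_n) : RatFun n := indet n (4 + i).
Definition Xu n (i : 'I_n) : RatFun n := indet n (4 + n + i).

(* Main.v *)
(* Fix the starting points w_j = u_j q^{k_j}. A multivariable (A-type) Jackson sum,
   over all lambda >= k with |lambda| <= M, has a closed form J(k); it follows by adding
   boxes one at a time, each step being a partial fraction expansion. Multiplying and
   dividing the k-th summand by J(k) turns the left-hand side into a double sum over
   k <= lambda. For fixed lambda the term is a constant times the determinant times a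
   product of functions theta_i(k_i), so the sum over k is the determinant of the
   one-dimensional sums over the rows. With p(z) and r(z) the monic polynomials of degree
   n + 1 whose roots are 1/(t_0 q^{|lambda|}), u_i q^{lambda_i} and 1/t_0, u_i
   respectively (they have the same constant term), the coefficients of (p - r)/z give a
   linear relation between the columns: in each row it telescopes to zero. Hence only
   lambda = 0 contributes, and this contribution is the right-hand side. *)
Require Import Defs.
From mathcomp Require Import all_boot all_order all_algebra.
From mathcomp Require Import fraction.
From mathcomp Require Import mpoly perm ring zify.
Set Implicit Arguments. Unset Strict Implicit. Unset Printing Implicit Defensive.
Import Order.TTheory GRing.Theory Num.Theory.
Local Open Scope ring_scope.

(** * Partial fractions *)

(** The obstacle is the coupling of the indices: by [interaction_factor] they meet in (t_j u_i /
    (u_j q^{k_j}); q)_{k_i}. The Jackson sum is given the parameters t_j / (u_j q^{k_j}), so its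
    weight extends these factorials from length k_i to length lambda_i. For fixed lambda each of
    them then involves k_j alone, and the indices separate. The bound |lambda| <= M becomes an
    equation through one more point [z0] = 1/(t_0 q^M), carrying M - |lambda| boxes. Its top point
    1/(t_0 q^{|lambda|}) is the extra root of p, so the roots of p are exactly the top points of
    lambda. The u_j q^{k_j} cancel between parameters and points, so the balancing value [B] does
    not depend on k. Dividing by J(k) and by values of r requires nonvanishing. The identity is
    therefore proved over any field in which certain pairs of monomials differ; for indeterminates
    this is a comparison of exponents. *)

Lemma big_option (R : Type) (idx : R) (op : Monoid.com_law idx) (I : finType)
    (P : pred (option I)) (f : option I -> R) :
  \big[op/idx]_(o | P o) f o =
  op (if P None then f None else idx) (\big[op/idx]_(i | P (Some i)) f (Some i)).
Proof.
rewrite big_mkcond (bigD1 None) //=; congr (op _ _).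
rewrite (reindex_omap Some id) => [|[i|] //].
rewrite [RHS]big_mkcond; apply: eq_bigl => i /=; by rewrite eqxx.
Qed.

Section PartialFractions.
Variable F : fieldType.

Lemma prodr_const_seq (T : Type) (s : seq T) (c : F) : \prod_(x <- s) c = c ^+ size s.
Proof. by rewrite big_const_seq count_predT -Monoid.iteropE. Qed.

(** Lagrange interpolation at the [x i], compared in degree [#|I|.-1]: each basis polynomial [l i]
    is monic of that degree. *)
Lemma divided_difference (I : finType) (x : I -> F) (p : {poly F}) :
    injective x -> (size p <= #|I|)%N ->
  \sum_i p.[x i] / \prod_(j | j != i) (x i - x j) = p`_(#|I|.-1).
Proof.
move=> x_inj sz_p.
pose l i : {poly F} := \prod_(j | j != i) ('X - (x j)%:P).
have l_enum i : l i = \prod_(j <- enum (predC1 i)) ('X - (x j)%:P).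
  by rewrite /l -big_enum.
have sz_l i : size (l i) = #|I|.
  rewrite l_enum size_prod_XsubC -cardE cardC1 prednK //.
  by apply/card_gt0P; exists i.
have l_root i j : j != i -> (l i).[x j] = 0.
  by move=> ji; rewrite /l horner_prod (bigD1 j) //= !hornerE subrr mul0r.
have lE i : (l i).[x i] = \prod_(j | j != i) (x i - x j).
  by rewrite /l horner_prod; apply: eq_bigr => j _; rewrite !hornerE.
have l_neq0 i : (l i).[x i] != 0.
  rewrite lE; apply/prodf_neq0 => j ji; rewrite subr_eq0.
  by apply: contra ji => /eqP /x_inj ->.
pose L := \sum_i (p.[x i] / (l i).[x i]) *: l i.
have pL : p = L.
  apply/eqP; rewrite -subr_eq0; apply/eqP.
  apply: (@roots_geq_poly_eq0 _ _ [seq x i | i <- enum I]).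
  - apply/allP => _ /mapP[i _ ->]; rewrite rootE hornerD hornerN horner_sum.
    rewrite (bigD1 i) //= big1 => [|j ji].
      by rewrite addr0 hornerZ divfK ?subrr.
    by rewrite hornerZ (l_root j i) ?mulr0 // eq_sym.
  - by rewrite map_inj_uniq ?enum_uniq.
  - rewrite size_map -cardE (leq_trans (size_polyD _ _)) // geq_max sz_p size_polyN.
    apply: (leq_trans (size_sum _ _ _)); apply/bigmax_leqP => i _.
    by apply: (leq_trans (size_scale_leq _ _)); rewrite sz_l.
rewrite [in RHS]pL coef_sum; apply: eq_bigr => i _.
rewrite coefZ -lE -(sz_l i) -lead_coefE.
have /monicP -> : l i \is monic by apply: monic_prod => j _; apply: monicXsubC.
by rewrite mulr1.
Qed.

(** [divided_difference] for \prod_x (1 - x X) at the nodes 0, 1/B and z_i. The balance condition on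
    B makes the term of the node 0 equal to the leading coefficient; these cancel, and the node 1/B
    gives the right-hand side. *)
Lemma partial_fractions (I : finType) (z : I -> F) (a : seq F) (B : F) :
    size a = #|I|.+1 -> injective z -> (forall i, z i != 0) ->
    (forall x, x \in a -> x != 0) -> (forall i, 1 - B * z i != 0) ->
    B = \prod_(x <- a) x * \prod_i z i ->
  \sum_i \prod_(x <- a) (1 - x * z i)
         / ((1 - B * z i) * z i * \prod_(j | j != i) (z j - z i))
  = \prod_(x <- a) (1 - B / x) / (\prod_i z i * \prod_i (1 - B * z i)).
Proof.
move=> sz_a z_inj z0 a0 Bz0 defB.
have Pa0 : \prod_(x <- a) x != 0 by rewrite prodf_seq_neq0; apply/allP => x /a0.
have Pz0 : \prod_i z i != 0 by apply/prodf_neq0.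
have B0 : B != 0 by rewrite defB mulf_neq0.
pose y (o : option (option I)) : F :=
  if o is Some o' then if o' is Some i then z i else B^-1 else 0.
have zB i : z i != B^-1.
  apply: contraNneq (Bz0 i) => ->; by rewrite mulfV ?subrr.
have y_inj : injective y.
  move=> [[i|]|] [[j|]|] //= /eqP.
  - by move=> /eqP /z_inj ->.
  - by rewrite (negPf (zB i)).
  - by rewrite (negPf (z0 i)).
  - by rewrite eq_sym (negPf (zB j)).
  - by rewrite invr_eq0 (negPf B0).
  - by rewrite eq_sym (negPf (z0 j)).
  - by rewrite eq_sym invr_eq0 (negPf B0).
pose p : {poly F} := \prod_(x <- a) (1 - x *: 'X).
have pE v : p.[v] = \prod_(x <- a) (1 - x * v).
  by rewrite /p horner_prod; apply: eq_bigr => x _; rewrite !hornerE.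
have sz_p (s : seq F) : (size (\prod_(x <- s) (1 - x *: 'X))%R <= (size s).+1)%N
    /\ (\prod_(x <- s) (1 - x *: 'X))`_(size s) = \prod_(x <- s) - x :> F.
  elim: s => [|x s [IHs IHc]]; first by rewrite !big_nil size_poly1 coef1.
  rewrite !big_cons mulrBl mul1r -scalerAl; split.
    apply: leq_trans (size_polyD _ _) _; rewrite geq_max (leqW IHs) /= size_polyN.
    apply: leq_trans (size_scale_leq _ _) _.
    by rewrite mulrC; apply: leq_trans (size_polyMleq _ _) _; rewrite size_polyX addn2.
  rewrite coefB coefZ coefXM /= IHc nth_default ?sub0r ?mulNr //.
have := @divided_difference _ y p y_inj.
rewrite !card_option -sz_a => /(_ (sz_p a).1); rewrite /= (sz_p a).2.
rewrite !big_option /= !pE !mul1r subr0.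
have -> : \prod_(x <- a) (1 - x * 0) = 1 by apply: big1_seq => x _; rewrite mulr0 subr0.
pose s : F := (-1) ^+ #|I|.
have s1 : s = 1 \/ s = -1 by rewrite /s -signr_odd; case: odd; [right | left].
have -> : \prod_i (0 - z i) = s * \prod_i z i.
  by rewrite (eq_bigr (fun i => - z i)) ?prodrN // => i _; rewrite sub0r.
have -> : \prod_i (B^-1 - z i) = B ^- #|I| * \prod_i (1 - B * z i).
  rewrite -exprVn -prodr_const -big_split /=; apply: eq_bigr => i _.
  by rewrite mulrBr mulr1 mulrA mulVf // mul1r.
have -> : \prod_(x <- a) - x = - s * \prod_(x <- a) x.
  rewrite (eq_bigr (fun x => -1 * x)) => [|x _]; last by rewrite mulN1r.
  by rewrite big_split prodr_const_seq sz_a exprS mulN1r.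
have -> : \prod_(x <- a) (1 - x / B) =
    - s * (\prod_(x <- a) x) / B ^+ #|I|.+1 * \prod_(x <- a) (1 - B / x).
  have -> : - s = (-1) ^+ size a by rewrite sz_a exprS mulN1r.
  rewrite -exprVn -sz_a -!prodr_const_seq -!big_split /=.
  apply: eq_big_seq => x /a0 x0; by field; rewrite x0 B0.
set S := \sum_i _; set S' := \sum_i _.
have -> : S = s * B * S'.
  rewrite /S /S' mulr_sumr; apply: eq_bigr => i _.
  rewrite pE 2!big_option /= subr0.
  have -> : \prod_(j | j != i) (z i - z j) = - s * \prod_(j | j != i) (z j - z i).
    have -> : - s = (-1) ^+ #|predC1 i|.
      rewrite cardC1 /s; have : (0 < #|I|)%N by apply/card_gt0P; exists i.
      by case: #|I| => // m _; rewrite exprS mulN1r opprK.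
    by rewrite -prodrN; apply: eq_bigr => j _; rewrite opprB.
  have d0 : \prod_(j | j != i) (z j - z i) != 0.
    apply/prodf_neq0 => j ji; rewrite subr_eq0.
    by apply: contra ji => /eqP/z_inj ->.
  move: (z0 i) (Bz0 i) d0; move: (z i) (\prod_(j | _) _) (\prod_(x <- a) _) => v d e v0 Bv0 d0.
  have Bv1 : v * B - 1 != 0 by rewrite -opprB oppr_eq0 mulrC.
  by case: s1 => ->; field; rewrite ?v0 ?B0 ?Bv0 ?d0 ?Bv1 ?oppr_eq0 ?oner_eq0.
have D0 : \prod_i (1 - B * z i) != 0 by apply/prodf_neq0.
rewrite exprS; have Bm0 : B ^+ #|I| != 0 by rewrite expf_neq0.
move: defB Pa0 Pz0 D0 Bm0; move: (B ^+ _) (\prod_(x <- a) (1 - B / x)) (\prod_(x <- a) x) => Bm R A.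
move: (\prod_i z i) (\prod_i (1 - B * z i)) => Z D defB A0 Z0 D0 Bm0 E0.
(* The bracket is the difference of the two sides of [E0]. With it added, the equation for [S'] is a
   field identity once B is replaced by A Z. *)
have E : S' = R / (Z * D) + s * B ^-1 * ((1 / ((0 - B^-1) * (s * Z)) +
 (- s * A / (B * Bm) * R / (B^-1 * (Bm^-1 * D)) + s * B * S')) + s * A).
  by move: B0; rewrite defB; case: s1 => ->; move=> B0; field; rewrite ?A0 ?Z0 ?D0 ?Bm0 ?oppr_eq0 ?oner_eq0.
by rewrite E0 in E; rewrite E mulNr addNr mulr0 addr0.
Qed.
End PartialFractions.

(** * The multivariable Jackson sum *)

Lemma sum_nat_eq1 (I : finType) (i : I) : (\sum_j (j == i) = 1)%N.
Proof. by rewrite (bigD1 i) //= eqxx big1 // => j /negPf ->. Qed.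

(** Removing a box from row i inverts adding one. The bound [N < b] keeps the incremented values
    inside ['I_b.+1], where [inord] does not fall back on its default. *)
Lemma sum_ffun_incr (V : nmodType) (I : finType) (b N : nat) (i : I)
    (f : (I -> nat) -> V) : (forall k k', k =1 k' -> f k = f k') -> (N < b)%N ->
  \sum_(k : {ffun I -> 'I_b.+1} | (\sum_j k j == N.+1)%N && (0 < k i)%N)
      f (fun j => k j - (j == i))%N
  = \sum_(k : {ffun I -> 'I_b.+1} | (\sum_j k j == N)%N) f (fun j => k j).
Proof.
move=> f_ext Nb.
pose h (k : {ffun I -> 'I_b.+1}) := [ffun j => inord (k j + (j == i))] : {ffun I -> 'I_b.+1}.
pose h' (k : {ffun I -> 'I_b.+1}) := [ffun j => inord (k j - (j == i))] : {ffun I -> 'I_b.+1}.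
have h'E (k : {ffun I -> 'I_b.+1}) j : h' k j = (k j - (j == i))%N :> nat.
  by rewrite ffunE inordK // ltnS (leq_trans (leq_subr _ _)) // -ltnS.
have hE (k : {ffun I -> 'I_b.+1}) j : (\sum_j k j = N)%N -> h k j = (k j + (j == i))%N :> nat.
  move=> sk; rewrite ffunE inordK // ltnS.
  have : (k j <= N)%N by rewrite -sk (bigD1 j) //= leq_addr.
  by case: (j == i) => /=; lia.
have sum_eq := sum_nat_eq1 i.
rewrite (reindex_onto h h') => [|k /andP[/eqP sk ki]]; last first.
  apply/ffunP => j; apply: val_inj; rewrite /= ffunE inordK h'E.
    by case: eqP => [->|_] /=; lia.
  by have := ltn_ord (k j); case: eqP => [->|_] /=; lia.
apply: eq_big => [k|k /andP[/andP[/eqP sk ki] /eqP hk]]; last first.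
  by apply: f_ext => j; rewrite -{2}hk h'E.
apply/idP/eqP => [/andP[/andP[/eqP sk ki] /eqP hk]|sk].
  have : (\sum_j h k j = \sum_j k j + 1)%N.
    rewrite -sum_eq -big_split /=; apply: eq_bigr => j _.
    rewrite -{2}hk h'E subnK //; by case: eqP => [->|].
  by rewrite sk addn1 => -[].
have -> : (\sum_j h k j = N.+1)%N.
  transitivity (N + 1)%N; last by rewrite addn1.
  by rewrite -sum_eq -sk -big_split /=; apply: eq_bigr => j _; exact: hE.
rewrite eqxx (hE k i sk) eqxx addn1 /=; apply/eqP/ffunP => j.
by apply: val_inj; rewrite /= h'E hE // addnK.
Qed.

Section Jackson.
Variables (F : fieldType) (I : finType) (q : F) (z : I -> F) (a : seq F) (B : F).

Definition box_factor (v : F) := \prod_(x <- a) (1 - x * v) / (1 - B * v).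

Definition boxes (k : I -> nat) (x : F) := \prod_l \prod_(s < k l) (x - z l * q ^+ s).

(* Up to a power of [q] this is the usual A-type weight, with a Vandermonde quotient
   over [\prod_(i, j) (q z_i / z_j; q)_(k_i)]; writing it as a product over the
   boxes [z_i q^s], [s < k_i], against the top points [z_j q^(k_j)] makes adding
   one box a rational one-step operation. *)
Definition weight (k : I -> nat) : F :=
  (\prod_i \prod_(s < k i) box_factor (z i * q ^+ s)) /
  \prod_j boxes k (z j * q ^+ k j).

Lemma eq_weight k k' : k =1 k' -> weight k = weight k'.
Proof.
move=> kk'; rewrite /weight /boxes; congr (_ / _).
  by apply: eq_bigr => i _; rewrite kk'.
apply: eq_bigr => j _; rewrite kk'; apply: eq_bigr => i _; by rewrite kk'.
Qed.

(** Since q x - z_l q^{s+1} = q (x - z_l q^s), the shift moves the boxes of a row by one place, and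
    only the two end factors of the row differ. *)
Lemma boxes_shift k x :
  boxes k (q * x) * \prod_l (q * x - z l * q ^+ k l) =
  q ^+ (\sum_l k l) * boxes k x * \prod_l (q * x - z l).
Proof.
rewrite -prodrXr -!big_split /=; apply: eq_bigr => l _.
elim: (k l) => [|m IH]; first by rewrite !big_ord0 expr0 !mulr1 !mul1r.
rewrite !big_ord_recr /= !exprS in IH *.
by transitivity ((\prod_(i < m) (q * x - z l * q ^+ i) * (q * x - z l * q ^+ m))
   * (q * (x - z l * q ^+ m))); [ring | rewrite IH; ring].
Qed.

Lemma boxes_incr k i x :
  boxes (fun j => k j + (j == i))%N x = boxes k x * (x - z i * q ^+ k i).
Proof.
rewrite /boxes (bigD1 i) //= [in RHS](bigD1 i) //= eqxx addn1 big_ord_recr /=.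
rewrite -!mulrA; congr (_ * _); rewrite mulrC; congr (_ * _).
by apply: eq_bigr => j /negPf ->; rewrite addn0.
Qed.

Hypotheses (q0 : q != 0) (q1 : forall m, q ^+ m.+1 != 1) (z0 : forall i, z i != 0).
Hypothesis zz : forall i j, i != j -> forall m l, z i * q ^+ m != z j * q ^+ l.
Hypothesis Bz : forall i m, 1 - B * (z i * q ^+ m) != 0.
Hypothesis a0 : forall x, x \in a -> x != 0.
Hypothesis size_a : size a = #|I|.+1.
Hypothesis defB : B = \prod_(x <- a) x * \prod_i z i.

Lemma expq_inj m l : q ^+ m = q ^+ l -> m = l.
Proof.
wlog ml : m l / (m <= l)%N.
  by move=> H /[dup] E /esym E'; case: (leqP m l) => [/H|/ltnW/H] ->.
move: ml => /subnKC <-; case: (l - m)%N => [|d]; first by rewrite addn0.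
rewrite exprD => /eqP; rewrite -{1}[q ^+ m]mulr1 (inj_eq (mulfI _)) ?expf_neq0 //.
by rewrite eq_sym (negPf (q1 d)).
Qed.

Lemma boxes_neq0 k i m : (k i <= m)%N -> boxes k (z i * q ^+ m) != 0.
Proof.
move=> kim; apply/prodf_neq0 => j _; apply/prodf_neq0 => -[s /= sk] _; rewrite subr_eq0.
have [ij|ij] := eqVneq i j; last exact: zz.
subst j; rewrite (inj_eq (mulfI (z0 i))); apply/eqP => /expq_inj E.
by move: sk; lia.
Qed.

Lemma top_inj k : injective (fun i => z i * q ^+ k i).
Proof. by move=> i j; have [//|ij /eqP] := eqVneq i j; rewrite (negPf (zz ij _ _)). Qed.

(** A box added to row i brings its own [box_factor] and a new factor Z_j - Z_i for every other top
    point. The top point of row i itself moves from Z_i to q Z_i, and [boxes_shift] measures this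
    move. *)
Lemma weight_incr k i (Z := fun j => z j * q ^+ k j) :
  weight (fun j => k j + (j == i))%N * (q ^+ (\sum_l k l) * \prod_l (q * Z i - z l)
     * \prod_(j | j != i) (Z j - Z i))
  = weight k * box_factor (Z i) * \prod_(j | j != i) (q * Z i - Z j).
Proof.
set k' := fun j => _.
have numE : \prod_j \prod_(s < k' j) box_factor (z j * q ^+ s) =
    \prod_j \prod_(s < k j) box_factor (z j * q ^+ s) * box_factor (Z i).
  rewrite (bigD1 i) //= [in RHS](bigD1 i) //= /k' eqxx addn1 big_ord_recr /=.
  rewrite [LHS]mulrAC; congr (_ * _ * _).
  by apply: eq_bigr => j /negPf ->; rewrite addn0.
have ZqZ : z i * q ^+ k' i = q * Z i by rewrite /k' eqxx addn1 exprS /Z; ring.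
have := boxes_shift k (Z i); rewrite -/Z (bigD1 i) //= -/(Z i).
have Zii : q * Z i - Z i != 0.
  rewrite -{2}[Z i]mul1r -mulrBl mulf_neq0 ?(mulf_neq0 (z0 i)) ?expf_neq0 //.
  by rewrite subr_eq0 (q1 0).
have P1 : \prod_(j | j != i) (Z j - Z i) != 0.
  by apply/prodf_neq0 => j ji; rewrite subr_eq0 zz.
have P2 : \prod_(j | j != i) (q * Z i - Z j) != 0.
  by apply/prodf_neq0 => j ji; rewrite subr_eq0 -ZqZ zz // eq_sym.
have B1 : boxes k (q * Z i) != 0 by rewrite -ZqZ boxes_neq0 // /k' leq_addr.
have B2 : boxes k (Z i) != 0 by rewrite boxes_neq0.
have B3 : \prod_(j | j != i) boxes k (Z j) != 0.
  by apply/prodf_neq0 => j _; rewrite boxes_neq0.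
have denE : \prod_j boxes k' (z j * q ^+ k' j) = boxes k (q * Z i) * (q * Z i - Z i)
    * (\prod_(j | j != i) boxes k (Z j) * \prod_(j | j != i) (Z j - Z i)).
  rewrite (bigD1 i) //= ZqZ boxes_incr -big_split /=; congr (_ * _).
  by apply: eq_bigr => j ji; rewrite boxes_incr /k' (negPf ji) addn0.
have denE0 : \prod_j boxes k (z j * q ^+ k j) =
    boxes k (Z i) * \prod_(j | j != i) boxes k (Z j) by rewrite (bigD1 i).
rewrite /weight numE denE denE0 => {numE denE denE0 ZqZ}.
move: P1 P2 B1 B2 B3 Zii; move: (boxes k (q * Z i)) (boxes k (Z i)) => b1 b2.
move: (\prod_(j | j != i) boxes k (Z j)) (\prod_(j | j != i) (Z j - Z i)) => b3 p1.
move: (\prod_(j | j != i) (q * Z i - Z j)) (\prod_l (q * Z i - z l)) => p2 p3.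
move: (q * Z i - Z i) (\prod_j \prod_(s < k j) _) (box_factor _) (q ^+ _) => zii A b Q.
move=> P1 P2 B1 B2 B3 Zii E.
have {E} -> : p2 = Q * b2 * p3 / (b1 * zii).
  by rewrite -E mulrA [RHS]mulrC mulKf ?mulf_neq0.
by field; rewrite ?B1 ?B2 ?B3 ?P1 ?Zii.
Qed.


(** Quotient of the Jackson sums of sizes N + 1 and N. The sign, 1 - q^{N+1} and the product over B
    q^N z_j come from [weight_decomp], the other products from summing [add_box] over i. *)
Definition jackson_ratio (N : nat) : F :=
  - (\prod_(x <- a) (1 - B * q ^+ N / x))
  / ((1 - q ^+ N.+1) * \prod_j (1 - B * q ^+ N * z j) * (q ^+ N * \prod_j z j)).

(** A term of the partial fraction expansion at the top points with parameter B q^N, scaled by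
    \prod_j (1 - B q^N Z_j) so that for |k| = N its sum over i no longer depends on k. *)
Definition add_box N (k : I -> nat) i : F :=
  \prod_j (1 - B * q ^+ N * (z j * q ^+ k j)) *
  (\prod_(x <- a) (1 - x * (z i * q ^+ k i))
   / ((1 - B * q ^+ N * (z i * q ^+ k i)) * (z i * q ^+ k i)
      * \prod_(j | j != i) (z j * q ^+ k j - z i * q ^+ k i))).

Lemma eq_add_box N k k' i : k =1 k' -> add_box N k i = add_box N k' i.
Proof.
move=> kk'; rewrite /add_box !kk'; congr (_ * (_ / (_ * _))).
  by apply: eq_bigr => j _; rewrite kk'.
by apply: eq_bigr => j _; rewrite kk'.
Qed.

(* Partial fractions at the top points [z_i q^(k_i)] with parameters [1 / z_j] and
   [B / q]: the terms with [k_i = 0] vanish and the others remove the last box of row [i]. *)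
Lemma weight_decomp k N : (\sum_j k j = N.+1)%N ->
  weight k = - ((1 - q ^+ N.+1) * \prod_j (1 - B * q ^+ N * z j))^-1 *
    \sum_(i | (0 < k i)%N) weight (fun j => k j - (j == i))%N
       * add_box N (fun j => k j - (j == i))%N i.
Proof.
move=> sk; pose X j := z j * q ^+ k j.
have X0 j : X j != 0 by rewrite mulf_neq0 ?expf_neq0.
have B0 : B != 0.
  by rewrite defB mulf_neq0 //; [rewrite prodf_seq_neq0; apply/allP => x /a0 | apply/prodf_neq0].
have BX j : 1 - B * q ^+ N * X j != 0.
  by have := Bz j (N + k j); rewrite exprD /X; congr (_ != _); ring.
have PX : \prod_j X j = \prod_j z j * q ^+ N.+1 by rewrite big_split /= prodrXr sk.
have Pz0 : \prod_j z j != 0 by apply/prodf_neq0.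
pose a' := B / q :: [seq (z j)^-1 | j <- enum I].
have size_a' : size a' = #|I|.+1 by rewrite /= size_map -cardE.
have a'0 x : x \in a' -> x != 0.
  rewrite inE => /orP[/eqP->|/mapP[j _ ->]]; rewrite ?invr_eq0 //.
  by rewrite mulf_neq0 ?invr_eq0.
have balance : B * q ^+ N = \prod_(x <- a') x * \prod_j X j.
  rewrite big_cons big_map big_enum /= prodfV PX exprS; by field; rewrite Pz0 q0.
have := partial_fractions size_a' (@top_inj k) X0 a'0 BX balance.
have a'E f : \prod_(x <- a') f x = f (B / q) * \prod_j f (z j)^-1 :> F.
  by rewrite big_cons big_map big_enum.
rewrite a'E PX; set C := (X in _ = X) => sumC.
have {}sumC : \sum_i (1 - B / q * X i) * \prod_j (1 - (z j)^-1 * X i) /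
    ((1 - B * q ^+ N * X i) * X i * \prod_(j | j != i) (X j - X i)) = C.
  by rewrite -sumC; apply: eq_bigr => i _; rewrite a'E.
have G0 : \prod_j (1 - B * q ^+ N * z j) != 0.
  apply/prodf_neq0 => j _; have := Bz j N; congr (_ != _); ring.
have d0 : 1 - q * q ^+ N != 0 by rewrite subr_eq0 eq_sym -exprS.
have PBX0 : \prod_j (1 - B * q ^+ N * X j) != 0 by apply/prodf_neq0.
have CE : C = (1 - q * q ^+ N) * \prod_j (1 - B * q ^+ N * z j) /
    (\prod_j z j * (q * q ^+ N) * \prod_j (1 - B * q ^+ N * X j)).
  rewrite /C -exprS; congr (_ * _ / _).
    by rewrite exprS; field; rewrite q0 B0.
  by apply: eq_bigr => j _; rewrite invrK.
have qN0 : q ^+ N != 0 by rewrite expf_neq0.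
have C0 : C != 0 by rewrite CE !mulf_neq0 ?invr_eq0 ?mulf_neq0.
(* [weight k] is multiplied by the expansion of the nonzero [C] and divided by [C]; the i-th term is
   then matched with the removal of a box from row i. *)
rewrite -[LHS](mulfK C0) -{1}sumC mulr_sumr mulr_suml mulr_sumr.
rewrite [RHS]big_mkcond /=; apply: eq_bigr => i _.
have [ki|] := posnP (k i).
  rewrite (_ : \prod_j (1 - (z j)^-1 * X i) = 0) ?(mulr0, mul0r) //.
  by rewrite (bigD1 i) //= /X ki mulr1 mulVf // subrr mul0r.
move=> ki; set k' := fun j => (k j - (j == i))%N.
have k'K : (fun j => k' j + (j == i))%N =1 k.
  by move=> j; rewrite /k' subnK //; case: eqP => [->|].
have sk' : (\sum_j k' j = N)%N.
  have : (\sum_j (k' j + (j == i)) = N.+1)%N by rewrite -sk; apply: eq_bigr => j _; exact: k'K.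
  by rewrite big_split /= sum_nat_eq1 addn1 => -[].
have := weight_incr k' i; rewrite (eq_weight k'K) sk'.
pose Z j := z j * q ^+ k' j.
have Xi : X i = q * Z i by rewrite /X -k'K eqxx addn1 exprS /Z; ring.
have Xj j : j != i -> X j = Z j by rewrite /X -k'K => /negPf ->; rewrite addn0.
have Z0 j : Z j != 0 by rewrite mulf_neq0 ?expf_neq0.
have p10 : \prod_(j | j != i) (Z j - Z i) != 0.
  by apply/prodf_neq0 => j ji; rewrite subr_eq0 zz.
have qZ j : j != i -> q * Z i - Z j != 0.
  by move=> ji; rewrite -Xi -Xj // subr_eq0 zz // eq_sym.
have p20 : \prod_(j | j != i) (q * Z i - Z j) != 0 by apply/prodf_neq0.
(* As X_j - X_i = -(q Z_i - Z_j) for j != i, all signs pair off except that of the factor j = i.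
   This is the minus sign of [jackson_ratio]. *)
have -> : \prod_j (1 - (z j)^-1 * X i) = - (\prod_j (q * Z i - z j) / \prod_j z j
    / \prod_(j | j != i) (q * Z i - Z j)) * \prod_(j | j != i) (X j - X i).
  rewrite (bigD1 i) //= [\prod_j (q * _ - _)](bigD1 i) //= [\prod_j z j](bigD1 i) //=.
  rewrite (eq_bigr (fun j => (q * Z i - z j) / z j / (q * Z i - Z j) * (X j - X i))).
    rewrite big_split 2!big_split /= !prodfV Xi.
    have Pz1 : \prod_(j | j != i) z j != 0 by apply/prodf_neq0.
    by field; rewrite p20 Pz1 z0.
  move=> j ji; rewrite Xi Xj //; have := qZ j ji; have := z0 j.
  by move=> h1 h2; field; rewrite h1 h2.
have p30 : \prod_(j | j != i) (X j - X i) != 0.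
  by apply/prodf_neq0 => j ji; rewrite subr_eq0 zz.
rewrite /add_box -/(Z i) /box_factor -/(Z i).
have E1 : \prod_j (1 - B * q ^+ N * X j) = (1 - B * q ^+ N * X i) * \prod_(j | j != i) (1 - B * q ^+ N * Z j).
  by rewrite (bigD1 i) //=; congr (_ * _); apply: eq_bigr => j ji; rewrite Xj.
have E2 : \prod_j (1 - B * q ^+ N * Z j) = (1 - B * q ^+ N * Z i) * \prod_(j | j != i) (1 - B * q ^+ N * Z j).
  by rewrite (bigD1 i).
rewrite /= E2 CE E1; rewrite E1 mulf_eq0 negb_or in PBX0; case/andP: PBX0 => e10 R0.
have e00 : 1 - B * q ^+ N * Z i != 0.
  by have := Bz i (N + k' i); rewrite exprD /Z; congr (_ != _); ring.
have bz0 : 1 - B * Z i != 0 := Bz i (k' i).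
have eZ1 : \prod_(j | j != i) (z j * q ^+ k' j - Z i) = \prod_(j | j != i) (Z j - Z i) by [].
have eZ2 : \prod_(j | j != i) (q * Z i - z j * q ^+ k' j) = \prod_(j | j != i) (q * Z i - Z j) by [].
rewrite eZ1 eZ2 exprS Xi; rewrite Xi in e10 p30.
move: (Z0 i) bz0 e00 R0 e10 p30 p20 p10 d0 qN0 G0 Pz0; clear - q0.
move: (\prod_(j | j != i) (1 - B * q ^+ N * Z j)) => R.
move: (\prod_(j | j != i) (X j - q * Z i)) => p3.
move: (\prod_(j | j != i) (q * Z i - Z j)) => p2.
move: (\prod_(j | j != i) (Z j - Z i)) => p1.
move: (\prod_j (1 - B * q ^+ N * z j)) => G.
move: (\prod_j (q * Z i - z j)) => P.
move: (\prod_j z j) => Zp.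
move: (\prod_(x <- a) (1 - x * Z i)) (weight k) (weight k') => A w w'.
move: (Z i) (q ^+ N) => v Q v0 b0 e00 R0 e10 p30 p20 p10 d0 Q0 G0 Zp0 E.
have {E} wA : w' * A = w * (Q * P * p1) / p2 * (1 - B * v).
  rewrite E; by field; rewrite b0 p20.
rewrite (_ : w' * _ = w' * A * R / (v * p1)); last by field; rewrite v0 p10 e00.
rewrite wA; field.
by rewrite ?v0 ?p10 ?p20 ?p30 ?G0 ?d0 ?R0 ?e10 ?q0 ?Q0 ?Zp0.
Qed.

(** Induction on N. [weight_decomp] distributes each weight of size N + 1 over its last boxes.
    Collected by what remains after the removal, the terms form the partial fraction expansion with
    parameters [a] at the top points of some k of size N, whose value is the same for all such k. *)
Lemma jackson_sum b N : (N <= b)%N ->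
  \sum_(k : {ffun I -> 'I_b.+1} | (\sum_j k j == N)%N) weight (fun j => k j)
  = \prod_(m < N) jackson_ratio m.
Proof.
elim: N => [_|N IH Nb].
  rewrite big_ord0 (bigD1 [ffun=> ord0]) /=; last by rewrite big1 // => j _; rewrite ffunE.
  rewrite big1 => [|k /andP[/eqP /eqP]]; last first.
    rewrite sum_nat_eq0 => /forallP /= k0 /eqP[]; apply/ffunP => j; apply/val_inj.
    by rewrite /= ffunE; apply/eqP; exact: k0.
  rewrite addr0 (@eq_weight _ (fun=> 0%N)) => [|j]; last by rewrite ffunE.
  rewrite /weight big1 => [|i _]; last by rewrite big_ord0.
  rewrite big1 ?divr1 // => j _; rewrite /boxes big1 // => i _; by rewrite big_ord0.
rewrite big_ord_recr /= -{}IH ?(ltnW Nb) // mulr_suml.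
under eq_bigr => k /eqP sk do rewrite (weight_decomp sk).
rewrite -mulr_sumr (exchange_big_dep predT) //=.
have incr i : \sum_(k : {ffun I -> 'I_b.+1} | (\sum_j k j == N.+1)%N && (0 < k i)%N)
      weight (fun j => k j - (j == i))%N * add_box N (fun j => k j - (j == i))%N i =
    \sum_(k : {ffun I -> 'I_b.+1} | (\sum_j k j == N)%N)
      weight (fun j => k j) * add_box N (fun j => k j) i.
  apply: (@sum_ffun_incr _ _ _ _ i (fun k => weight k * add_box N k i)) => // k k' kk'.
  by rewrite (eq_weight kk') (eq_add_box _ _ kk').
rewrite (eq_bigr _ (fun i _ => incr i)).
rewrite exchange_big /= mulr_sumr; apply: eq_bigr => k /eqP sk.
rewrite -!mulr_sumr mulrCA; congr (_ * _).
pose Z j := z j * q ^+ k j.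
have Z0 j : Z j != 0 by rewrite mulf_neq0 ?expf_neq0.
have BZ j : 1 - B * q ^+ N * Z j != 0.
  by have := Bz j (N + k j); rewrite exprD /Z; congr (_ != _); ring.
have PZ : \prod_j Z j = \prod_j z j * q ^+ N by rewrite big_split /= prodrXr sk.
(* The top points have product q^N \prod_j z_j, so replacing B by B q^N keeps the balance. *)
have balance : B * q ^+ N = \prod_(x <- a) x * \prod_j Z j by rewrite PZ defB mulrA.
rewrite (partial_fractions size_a (@top_inj (fun j => k j)) Z0 a0 BZ balance) PZ /jackson_ratio.
have PBZ : \prod_j (1 - B * q ^+ N * Z j) != 0 by apply/prodf_neq0.
have Pz0 : \prod_j z j != 0 by apply/prodf_neq0.
have G0 : \prod_j (1 - B * q ^+ N * z j) != 0.
  apply/prodf_neq0 => j _; have := Bz j N; congr (_ != _); ring.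
have d0 : 1 - q ^+ N.+1 != 0 by rewrite subr_eq0 eq_sym.
have qN0 : q ^+ N != 0 by rewrite expf_neq0.
rewrite -/Z; move: PBZ G0 d0 Pz0 qN0.
by move=> PBZ G0 d0 Pz0 qN0; field; rewrite ?PBZ ?G0 ?d0 ?Pz0 ?qN0.
Qed.
End Jackson.

(** * Inversion through the determinant *)

(** Row i of the matrix involves only k_i, so in the Leibniz expansion the sum over k factors row by
    row for each permutation. *)
Lemma sum_det_rows (F : fieldType) (n : nat) (K : finType) (P : 'I_n -> pred K)
    (theta : 'I_n -> K -> F) (e : 'I_n -> K -> 'I_n -> F) :
  \sum_(k : {ffun 'I_n -> K} | k \in family P)
     (\prod_i theta i (k i)) * \det (\matrix_(i, j) e i (k i) j)
  = \det (\matrix_(i, j) \sum_(c | P i c) theta i c * e i c j).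
Proof.
rewrite /determinant; under eq_bigr do rewrite mulr_sumr.
rewrite exchange_big /=; apply: eq_bigr => s _.
under [in RHS]eq_bigr => i _ do rewrite mxE.
rewrite bigA_distr_big_dep mulr_sumr; apply: eq_bigr => k _.
rewrite mulrCA -big_split; congr (_ * _); apply: eq_bigr => i _.
by rewrite mxE.
Qed.

(** By the recurrence the subtracted part of term c + 1 equals theta(c) p(u q^c) / (u q^c), the main
    part of term c. The two ends vanish because r(u) = 0 and p(u q^l) = 0. *)
Lemma row_telescope (F : fieldType) (p r : {poly F}) (q u t : F) (theta : nat -> F) l :
    q != 0 -> u != 0 -> r.[u] = 0 -> p.[u * q ^+ l] = 0 ->
    (forall c, (c < l)%N -> r.[u * q ^+ c.+1 / t] != 0) ->
    (forall c, (c < l)%N ->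
       theta c.+1 * (p.[u * q ^+ c.+1 / t] * r.[u * q ^+ c.+1]) =
       theta c * (q * p.[u * q ^+ c] * r.[u * q ^+ c.+1 / t])) ->
  \sum_(c < l.+1) theta c * ((p.[u * q ^+ c] -
     p.[u * q ^+ c / t] * (r.[u * q ^+ c] / r.[u * q ^+ c / t])) / (u * q ^+ c)) = 0.
Proof.
move=> q0 u0 ru pl rt rec.
suff partial m : (m <= l)%N -> \sum_(c < m.+1) theta c * ((p.[u * q ^+ c] -
     p.[u * q ^+ c / t] * (r.[u * q ^+ c] / r.[u * q ^+ c / t])) / (u * q ^+ c))
   = theta m * p.[u * q ^+ m] / (u * q ^+ m) by rewrite partial // pl mulr0 mul0r.
elim: m => [_|m IH ml].
  (* r(u) = 0 annihilates the subtracted part, whatever value the quotient by r(u/t) takes. *)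
  by rewrite big_ord1 expr0 mulr1 ru mul0r mulr0 subr0 mulrA.
rewrite big_ord_recr /= IH ?(ltnW ml) //.
have := rec m ml; have := rt m ml.
have qm0 : q ^+ m != 0 by rewrite expf_neq0.
have -> : u * q ^+ m.+1 = q * (u * q ^+ m) by rewrite exprS; ring.
have : u * q ^+ m != 0 by rewrite mulf_neq0.
move: (u * q ^+ m) => w w0; set w' := q * w.
have w'E : w' = q * w by [].
have : w' != 0 by rewrite mulf_neq0.
move: (theta _) (theta _) p.[_] p.[_] r.[_] r.[_] p.[_] => a b c d e f g w'0 f0 E.
have -> : b * ((c - g * (e / f)) / w') = (b * c - b * (g * e) / f) / w'.
  by field; rewrite w'0 f0.
by rewrite E w'E; field; rewrite w0 q0 f0.
Qed.

Lemma det_rows_eq0 (F : fieldType) (n : nat) (A : 'M[F]_n) (v : 'I_n -> F) j :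
  v j != 0 -> (forall i, \sum_j A i j * v j = 0) -> \det A = 0.
Proof.
move=> vj Av; apply/eqP; rewrite -det_tr; apply/det0P.
exists (\row_j v j); first by apply/eqP => /rowP/(_ j); rewrite !mxE; exact/eqP.
by apply/rowP => i; rewrite !mxE -[RHS](Av i); apply: eq_bigr => l _; rewrite !mxE mulrC.
Qed.

Section RowFunctional.
Variables (F : fieldType) (n : nat) (q t0 : F) (t u : 'I_n -> F).

(* The determinant entries encode the functional
   [h |-> (h(x) - Phi h(x / t_i)) / x] on polynomials [h] of degree at most [n]
   with [h(0) = 0], where [Phi = r(x) / r(x / t_i)]. *)
Lemma det_entry_poly (k : 'I_n -> nat) i (h : {poly F})
    (r := ('X - (t0^-1)%:P) * \prod_s ('X - (u s)%:P)) (x := u i * q ^+ k i) :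
    t0 != 0 -> x != 0 -> (size h <= n.+1)%N -> h`_0 = 0 ->
  \sum_j det_entry q t0 t u k i j * h`_(n - j) =
  (h.[x] - h.[x / t i] * (r.[x] / r.[x / t i])) / x.
Proof.
move=> t00 x0 sz_h h0.
have rE v : r.[v] = (v - t0^-1) * \prod_s (v - u s).
  rewrite /r !hornerE horner_prod; congr (_ * _); apply: eq_bigr => s _.
  by rewrite !hornerE.
have hE v : h.[v] = \sum_(j < n) h`_(n - j) * v ^+ (n - j).
  rewrite (horner_coef_wide _ sz_h) big_ord_recl h0 mul0r add0r.
  rewrite (reindex_inj rev_ord_inj); apply: eq_bigr => j _ /=.
  by rewrite /bump /= add1n subnSK.
rewrite !hE mulr_suml -sumrB mulr_suml; apply: eq_bigr => j _.
rewrite /det_entry -/x; clearbody x; rewrite !rE -(subnSK (ltn_ord j)).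
rewrite prodf_div !exprS.
have phi0 v : 1 - t0 * v = - t0 * (v - t0^-1) by field.
have nt0 : - t0 != 0 by rewrite oppr_eq0.
rewrite -[t0 * x / t i]mulrA !phi0 -mulf_div divff // mul1r -[in RHS]mulf_div.
rewrite invfM -exprVn exprMn.
move: ((x - t0^-1) / (x / t i - t0^-1)) => R.
move: (\prod_s (x - u s) / \prod_s (x / t i - u s)) => S.
move: (t i)^-1 => tv.
by field.
Qed.

(* Both polynomials are monic of degree [n + 1] with the same constant term, so the
   coefficients of [(p - r) / 'X] form a vector of length [n]; by telescoping it is
   annihilated by every row of the summed determinant. *)
Lemma inversion (b : nat) (lam : 'I_n -> nat) (theta : 'I_n -> nat -> F)
    (p := ('X - ((t0 * q ^+ (\sum_i lam i))^-1)%:P) * \prod_i ('X - (u i * q ^+ lam i)%:P))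
    (r := ('X - (t0^-1)%:P) * \prod_i ('X - (u i)%:P)) :
    q != 0 -> t0 != 0 -> (forall i, u i != 0) -> (forall i, (lam i <= b)%N) ->
    (exists i, (0 < lam i)%N) ->
    (forall i c, r.[u i * q ^+ c.+1] != 0) ->
    (forall i c, r.[u i * q ^+ c.+1 / t i] != 0) ->
    (forall i c, (c < lam i)%N ->
       theta i c.+1 * (p.[u i * q ^+ c.+1 / t i] * r.[u i * q ^+ c.+1]) =
       theta i c * (q * p.[u i * q ^+ c] * r.[u i * q ^+ c.+1 / t i])) ->
  \sum_(k : {ffun 'I_n -> 'I_b.+1} | k \in family (fun i => [pred c : 'I_b.+1 | (c <= lam i)%N]))
     (\prod_i theta i (k i)) *
     \det (\matrix_(i, j) det_entry q t0 t u (fun l => k l) i j) = 0.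
Proof.
move=> q0 t00 u0 lam_b [i0 lam_i0] r0 rt0 rec.
have monic_p (a : F) (f : 'I_n -> F) :
  ('X - a%:P) * \prod_i ('X - (f i)%:P) \is monic by
  rewrite monicMr ?monicXsubC ?monic_prod // => i _; exact: monicXsubC.
have size_p (a : F) (f : 'I_n -> F) :
    size (('X - a%:P) * \prod_i ('X - (f i)%:P)) = n.+2.
  rewrite size_monicM ?monicXsubC ?monic_neq0 ?monic_prod // => [|i _]; last exact: monicXsubC.
  by rewrite size_XsubC -big_enum size_prod_XsubC size_enum_ord.
have pE (a : F) (f : 'I_n -> F) x :
    (('X - a%:P) * \prod_i ('X - (f i)%:P)).[x] = (x - a) * \prod_i (x - f i).
  rewrite !hornerE horner_prod; congr (_ * _); apply: eq_bigr => i _.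
  by rewrite !hornerE.
pose h := p - r.
have ru i : r.[u i] = 0
  by rewrite pE [\prod_i _](bigD1 i) //= subrr mul0r mulr0.
have pl i : p.[u i * q ^+ lam i] = 0
  by rewrite pE [\prod_i _](bigD1 i) //= subrr mul0r mulr0.
have h0 : h`_0 = 0.
  rewrite -horner_coef0 hornerD hornerN !pE.
  rewrite (eq_bigr (fun i => (0 - u i) * q ^+ lam i)) => [|i _]; last by ring.
  rewrite big_split prodrXr /=; field; rewrite t00 expf_neq0 //.
have size_h : (size h <= n.+1)%N.
  apply/leq_sizeP => j; rewrite leq_eqVlt coefB => /orP[/eqP <-|jn].
    have lead1 (a : F) (f : 'I_n -> F) : (('X - a%:P) * \prod_i ('X - (f i)%:P))`_n.+1 = 1.
      by have /monicP := monic_p a f; rewrite lead_coefE size_p.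
    by rewrite (lead1 _ (fun i => u i * q ^+ lam i) : p`__ = 1) (lead1 _ u : r`__ = 1) subrr.
  by rewrite !nth_default ?subrr // size_p.
(* The kernel vector is nonzero: if p = r, then r would vanish at u_{i0} q^{lam i0}, which [r0]
   excludes as [lam i0] is positive. This is where lambda != 0 enters. *)
have [i1 hi1] : exists j : 'I_n, h`_(n - j) != 0.
  apply/existsP; apply/negbNE/existsPn => /= hj.
  have hE : h = 0.
    apply/polyP => j; rewrite coef0; case: (ltnP n j) => jn.
      by rewrite nth_default // (leq_trans size_h).
    have [->//|j0] := posnP j.
    have lt : (n - j < n)%N by lia.
    have /negP := hj (Ordinal lt); rewrite /= subKn // => /negP; by rewrite negbK => /eqP.
  have := r0 i0 (lam i0).-1; rewrite prednK // -[r](subKr p) -/h hE subr0 pl eqxx //.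
(* Row i reads k only at i, so the constant function with value c may stand for k there. *)
rewrite (@sum_det_rows _ _ _ _ (fun i (c : 'I_b.+1) => theta i c)
  (fun i (c : 'I_b.+1) j => det_entry q t0 t u (fun=> c) i j)).
apply: (det_rows_eq0 (v := fun j => h`_(n - j)) hi1) => i.
rewrite -[RHS](row_telescope q0 (u0 i) (ru i) (pl i) (fun c _ => rt0 i c) (rec i)).
rewrite (big_ord_widen b.+1 (fun c => theta i c * ((p.[u i * q ^+ c] -
  p.[u i * q ^+ c / t i] * (r.[u i * q ^+ c] / r.[u i * q ^+ c / t i])) / (u i * q ^+ c)))) ?ltnS //.
under eq_bigr do rewrite mxE mulr_suml.
rewrite exchange_big /=; apply: eq_big => c; first by rewrite ltnS.
move=> c_lam; under eq_bigr do rewrite -mulrA.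
have x0 : u i * q ^+ c != 0 by rewrite mulf_neq0 ?expf_neq0.
rewrite -mulr_sumr (@det_entry_poly (fun=> nat_of_ord c) i h) // -/r /h !(hornerD, hornerN).
congr (_ * (_ / _)).
have [c0|c_gt0] := posnP c; first by rewrite c0 expr0 mulr1 ru !(mul0r, mulr0, subr0).
have := rt0 i c.-1; rewrite prednK //.
by move=> rt; field.
Qed.
End RowFunctional.

(** * Shifted factorials *)

Section ShiftedFactorials.
Variables (F : fieldType) (q : F).

Definition qfac (a : F) (m : nat) : F := \prod_(s < m) (1 - a * q ^+ s).

(* [signq m = (-1)^m q^(m(m-1)/2)] *)
Definition signq (m : nat) : F := \prod_(s < m) - q ^+ s.

Lemma qpochE a m : qpoch a q (Posz m) = qfac a m. Proof. by []. Qed.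

Lemma qfac0 a : qfac a 0 = 1. Proof. exact: big_ord0. Qed.

Lemma qfacD a m l : qfac a (m + l) = qfac a m * qfac (a * q ^+ m) l.
Proof.
rewrite /qfac big_split_ord /=; congr (_ * _).
by apply: eq_bigr => s _; rewrite exprD mulrA.
Qed.

Lemma qfac_neq0 a m : (forall s, a * q ^+ s != 1) -> qfac a m != 0.
Proof. by move=> a1; apply/prodf_neq0 => s _; rewrite subr_eq0 eq_sym. Qed.

Lemma signqD m l : signq (m + l) = signq m * signq l * q ^+ (m * l).
Proof.
rewrite /signq big_split_ord /= -mulrA; congr (_ * _).
rewrite exprM -[X in q ^+ m ^+ X](card_ord l) -prodr_const -big_split /=.
by apply: eq_bigr => s _; rewrite exprD; ring.
Qed.

Lemma signq_sum n (k : 'I_n -> nat) :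
  signq (\sum_i k i) = \prod_i signq (k i) * \prod_(i < n) \prod_(j < n | (i < j)%N) q ^+ (k i * k j).
Proof.
elim: n k => [|n IH] k; first by rewrite !big_ord0 /signq big_ord0 mulr1.
rewrite !big_ord_recl signqD IH /= -!mulrA; congr (_ * (_ * _)).
rewrite mulrC; congr (_ * _).
  by rewrite [RHS]big_mkcond big_ord_recl /= mul1r prodrXr big_distrr.
apply: eq_bigr => i _; rewrite [RHS]big_mkcond big_ord_recl /= mul1r big_mkcond.
by apply: eq_bigr => j _; rewrite /bump !add1n ltnS.
Qed.

Hypothesis q0 : q != 0.

Lemma signq_neq0 m : signq m != 0.
Proof. by apply/prodf_neq0 => s _; rewrite oppr_eq0 expf_neq0. Qed.

Lemma signq_sqr m : signq m * signq m * q ^+ m = q ^+ (m * m).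
Proof.
elim: m => [|m IH]; first by rewrite /signq big_ord0 !mulr1.
rewrite /signq big_ord_recr /= -/(signq m).
rewrite (_ : m.+1 * m.+1 = m * m + m + m + 1)%N; last by lia.
by rewrite !exprD -IH exprS expr1; ring.
Qed.

(** 1 - c q^s = -c q^s (1 - q^{-s}/c), with the factors taken in reverse order. *)
Lemma qfac_rev c m : c != 0 -> qfac c m = c ^+ m * signq m * qfac (q / (c * q ^+ m)) m.
Proof.
move=> c0; rewrite /qfac /signq -[X in c ^+ X](card_ord m) -prodr_const.
rewrite [X in _ = _ * _ * X](reindex_inj rev_ord_inj) -!big_split /=.
apply: eq_bigr => s _; have sm := ltn_ord s.
rewrite (_ : q ^+ m = q * q ^+ s * q ^+ (m - s.+1)).
  by field; rewrite c0 q0 !expf_neq0.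
by rewrite -exprS -exprD; congr (_ ^+ _); lia.
Qed.

(** The last l factors of (a; q)_m are reversed by [qfac_rev]. This trades a factorial of length |k|
    or |k| - k_i with q^{-M} in its base for one of the complementary length in M, as they occur in
    a Jackson sum with M - |k| boxes. *)
Lemma qfac_compl a m l : a != 0 -> (l <= m)%N ->
  qfac (q / (a * q ^+ m)) l * (qfac a (m - l) * (a * q ^+ (m - l)) ^+ l * signq l) = qfac a m.
Proof.
move=> a0 lm; rewrite -[in RHS](subnK lm) qfacD.
rewrite [qfac (a * _) l]qfac_rev ?mulf_neq0 ?expf_neq0 //.
by rewrite -[a * _ * _]mulrA -exprD subnK //; ring.
Qed.

Lemma qpoch_neg a m : qpoch a q (- m%:Z) = (qfac (a / q ^+ m) m)^-1.
Proof.
case: m => [|m]; first by rewrite qfac0 invr1 /qpoch /= big_ord0.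
rewrite -NegzE /qpoch; congr _^-1; rewrite /qfac (reindex_inj rev_ord_inj).
apply: eq_bigr => s _ /=; have sm := ltn_ord s.
rewrite (_ : q ^+ m.+1 = q ^+ (m.+1 - s.+1).+1 * q ^+ s).
  by field; rewrite !expf_neq0.
by rewrite -exprD; congr (_ ^+ _); lia.
Qed.

(** The extra factorial makes the index natural for both signs of k - l: for k >= l it supplies the
    first l factors of (a q^{-l}; q)_k, for l > k the negative index cuts it down to k factors. *)
Lemma qpoch_subl a k l : (forall s, a / q ^+ s.+1 != 1) ->
  qfac (a / q ^+ l) l * qpoch a q (k%:Z - l%:Z) = qfac (a / q ^+ l) k.
Proof.
move=> a1; case: (leqP l k) => [/subnKC <-|/ltnW /subnKC <-].
  rewrite PoszD addrAC subrr add0r qpochE qfacD; congr (_ * qfac _ _).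
  by field; rewrite expf_neq0.
rewrite PoszD opprD addrA subrr add0r qpoch_neg qfacD.
have -> : a / q ^+ (k + (l - k)) * q ^+ k = a / q ^+ (l - k).
  by rewrite exprD; field; rewrite !expf_neq0.
rewrite mulfK //; apply/prodf_neq0 => s _; rewrite subr_eq0 eq_sym.
have sl := ltn_ord s; have := a1 (l - k - s.+1)%N; congr (_ != _).
rewrite (_ : q ^+ (l - k) = q ^+ (l - k - s.+1).+1 * q ^+ s).
  by field; rewrite !expf_neq0.
by rewrite -exprD; congr (_ ^+ _); lia.
Qed.

Lemma qpoch_subr a k l : (forall s, a / q ^+ s.+1 != 1) -> (forall s, a * q ^+ s != 1) ->
  qfac a k / qpoch a q (k%:Z - l%:Z) = qfac (a * q ^+ k / q ^+ l) l.
Proof.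
move=> a1 a2; case: (leqP l k) => [/subnKC <-|/ltnW /subnKC <-].
  rewrite PoszD addrAC subrr add0r qpochE addnC qfacD mulrC mulKf ?qfac_neq0 //.
  by congr (qfac _ _); rewrite exprD; field; rewrite expf_neq0.
rewrite PoszD opprD addrA subrr add0r qpoch_neg invrK [in RHS]addnC qfacD mulrC.
rewrite exprD; congr (qfac _ _ * qfac _ _); by field; rewrite !expf_neq0.
Qed.

(** Used for a pair i < j with x, y = u_i, u_j, s, t = t_i, t_j and k, l = k_i, k_j. Both auxiliary
    reversals have length l, so their [signq l] cancel and a monomial is left. Its part (q/(st))^l
    is absorbed by the explicit powers in the summand, and q^{kl} goes into [signq_sum]. *)
Lemma qpoch_pair x y s t k l : x != 0 -> y != 0 -> s != 0 -> t != 0 ->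
    (forall m p, x * q ^+ m != s * y * q ^+ p) -> (forall m p, y * q ^+ m != t * x * q ^+ p) ->
  qfac (q * x / (s * y)) k * qfac (q * y / (t * x)) l *
    (qpoch (t * x / y) q (k%:Z - l%:Z) / qpoch (q * x / (s * y)) q (k%:Z - l%:Z)) =
  (q ^+ k.+1 / (s * t)) ^+ l * (qfac (t * x / (y * q ^+ l)) k * qfac (s * y / (x * q ^+ k)) l).
Proof.
move=> x0 y0 s0 t0 xy yx.
have qm m : q ^+ m != 0 by rewrite expf_neq0.
have /(qpoch_subl k l) E1 : forall m, t * x / y / q ^+ m.+1 != 1.
  move=> m; apply: contraNneq (yx m.+1 0) => E; apply/eqP.
  by rewrite -[LHS]mul1r -{1}E expr0; field; rewrite y0 qm.
have E2 : qfac (q * x / (s * y)) k / qpoch (q * x / (s * y)) q (k%:Z - l%:Z) =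
    qfac (q * x / (s * y) * q ^+ k / q ^+ l) l.
  apply: qpoch_subr => m.
    apply: contraNneq (xy 1 m.+1) => E; apply/eqP; rewrite -[RHS]mul1r -{1}E expr1.
    by field; rewrite s0 y0 qm.
  apply: contraNneq (xy m.+1 0) => E; apply/eqP; rewrite -[RHS]mul1r -{1}E expr0 exprS.
  by field; rewrite s0 y0.
have txy0 : t * x / y != 0 by rewrite !mulf_neq0 ?invr_eq0.
have sxy0 : q * x / (s * y) != 0 by rewrite !mulf_neq0 ?invr_eq0 ?mulf_neq0.
have E3 := @qfac_rev (t * x / y / q ^+ l) l (mulf_neq0 txy0 (invr_neq0 (qm l))).
have E4 := @qfac_rev (q * x / (s * y) * q ^+ k / q ^+ l) l
   (mulf_neq0 (mulf_neq0 sxy0 (qm k)) (invr_neq0 (qm l))).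
have e3 : q / (t * x / y / q ^+ l * q ^+ l) = q * y / (t * x).
  by field; rewrite t0 x0 y0 qm.
have e4 : q / (q * x / (s * y) * q ^+ k / q ^+ l * q ^+ l) = s * y / (x * q ^+ k).
  by field; rewrite s0 x0 y0 q0 !qm.
rewrite e3 in E3; rewrite e4 in E4.
have e5 : t * x / y / q ^+ l = t * x / (y * q ^+ l) by field; rewrite y0 qm.
rewrite e5 in E1 E3.
rewrite [X in _ * X]mulrC mulrACA E2 E4 -E1 E3.
have -> : q * x / (s * y) * q ^+ k / q ^+ l = q ^+ k.+1 / (s * t) * (t * x / (y * q ^+ l)).
  by rewrite exprS; field; rewrite s0 y0 t0 qm.
by rewrite exprMn; ring.
Qed.
End ShiftedFactorials.

(** * Factorization of the summand *)

Lemma prod_pairs (R : comNzRingType) n (f : 'I_n -> 'I_n -> R) :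
  \prod_i \prod_j f i j =
  \prod_i f i i * \prod_(i < n) \prod_(j < n | (i < j)%N) (f i j * f j i).
Proof.
have -> : \prod_(i < n) \prod_(j < n | (i < j)%N) (f i j * f j i) =
    \prod_(i < n) \prod_(j < n | (i < j)%N) f i j * \prod_(i < n) \prod_(j < n | (j < i)%N) f i j.
  rewrite [X in _ = _ * X](exchange_big_dep predT) //= -big_split /=.
  by apply: eq_bigr => i _; rewrite -big_split.
rewrite -!big_split /=; apply: eq_bigr => i _.
rewrite (bigD1 i) //=; congr (_ * _); rewrite (bigID (fun j : 'I_n => (i < j)%N)) /=.
congr (_ * _); apply: eq_bigl => j; have : (j == i) = (j == i :> nat) by []; move=> ->; lia.
Qed.

Lemma prod_ord_lt (R : comNzRingType) n (c : 'I_n -> R) :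
  \prod_(i < n) \prod_(j < n | (i < j)%N) c j = \prod_j c j ^+ j.
Proof.
rewrite (exchange_big_dep predT) //=; apply: eq_bigr => j _.
by rewrite -(big_ord_widen n (fun=> c j)) ?(ltnW (ltn_ord j)) // prodr_const card_ord.
Qed.

Lemma prod_jackson_ratio (F : fieldType) (I : finType) (q : F) (z : I -> F) a B N :
  \prod_(m < N) jackson_ratio q z a B m =
  \prod_(x <- a) qfac q (B / x) N /
    (signq q N * (qfac q q N * \prod_j qfac q (B * z j) N) * (\prod_j z j) ^+ N).
Proof.
rewrite -[X in _ ^+ X](card_ord N) -prodr_const /qfac.
rewrite [\prod_j \prod_(s < N) _]exchange_big [\prod_(x <- a) _]exchange_big /=.
rewrite -!big_split -prodf_div /=; apply: eq_bigr => m _.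
rewrite /jackson_ratio -exprS.
have -> : \prod_(x <- a) (1 - B * q ^+ m / x) = \prod_(x <- a) (1 - B / x * q ^+ m).
  by apply: eq_bigr => x _; rewrite mulrAC.
have -> : \prod_j (1 - B * q ^+ m * z j) = \prod_j (1 - B * z j * q ^+ m).
  by apply: eq_bigr => x _; rewrite mulrAC.
rewrite mulNr -mulrN -invrN; congr (_ / _); ring.
Qed.

(** The coordinates lambda_i - k_i together with the slack M - |lambda| at [None] have total M - |k|
    whatever lambda is. *)
Lemma sum_above (V : nmodType) (n M : nat) (k : 'I_n -> nat) (f : (option 'I_n -> nat) -> V) :
    (forall m m', m =1 m' -> f m = f m') -> (absk k <= M)%N ->
  \sum_(m : {ffun option 'I_n -> 'I_M.+1} | (\sum_o m o == M - absk k)%N) f (fun o => m o) =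
  \sum_(lam : {ffun 'I_n -> 'I_M.+1} |
        (absk (fun i => lam i) <= M)%N && [forall i, k i <= lam i]%N)
     f (fun o => if o is Some i then (lam i - k i)%N else (M - absk (fun i => lam i))%N).
Proof.
move=> f_ext KM.
pose g (lam : {ffun 'I_n -> 'I_M.+1}) (o : option 'I_n) :=
  if o is Some i then (lam i - k i)%N else (M - absk (fun i => lam i))%N.
pose h (lam : {ffun 'I_n -> 'I_M.+1}) : {ffun option 'I_n -> 'I_M.+1} :=
  [ffun o => inord (g lam o)].
pose h' (m : {ffun option 'I_n -> 'I_M.+1}) : {ffun 'I_n -> 'I_M.+1} :=
  [ffun i => inord (m (Some i) + k i)].
have kK i : (k i <= absk k)%N by rewrite /absk (bigD1 i) //= leq_addr.
have kM i : (k i <= M)%N := leq_trans (kK i) KM.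
have hE lam o : h lam o = g lam o :> nat.
  rewrite ffunE inordK // ltnS /g; case: o => [i|]; last exact: leq_subr.
  by apply: leq_trans (leq_subr _ _) _; rewrite -ltnS.
have sum_option (m : option 'I_n -> nat) : (\sum_o m o = m None + \sum_i m (Some i))%N.
  by rewrite big_option.
have h'E (m : {ffun option 'I_n -> 'I_M.+1}) i : (\sum_o m o = M - absk k)%N ->
    h' m i = (m (Some i) + k i)%N :> nat.
  move=> sm; rewrite ffunE inordK // ltnS.
  rewrite -[X in (_ <= X)%N](subnK KM) leq_add // -sm (bigD1 (Some i)) //=; exact: leq_addr.
rewrite (reindex_onto h h') => [|m /eqP sm]; last first.
  apply/ffunP => -[i|]; apply/val_inj; rewrite /= hE /= ?h'E ?addnK //.
  have -> : absk (fun i => h' m i) = (\sum_i m (Some i) + absk k)%N.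
    by rewrite /absk -big_split; apply: eq_bigr => i _; rewrite h'E.
  move: sm KM; rewrite sum_option.
  by move: (absk k) (\sum_i m (Some i))%N (nat_of_ord (m None)) => a s c; lia.
apply: eq_big => [lam|lam _]; last by apply: f_ext => o; rewrite hE.
rewrite sum_option hE /= (eq_bigr (fun i => lam i - k i)%N) => [|i _]; last by rewrite hE.
apply/andP/andP => [[/eqP sl /eqP hl]|[lM /forallP kl]].
  have kl i : (k i <= lam i)%N.
    have := congr1 (fun m : {ffun 'I_n -> 'I_M.+1} => m i : nat) hl.
    rewrite /= ffunE hE /= inordK; first by lia.
    by have := kM i; have := ltn_ord (lam i); move: (nat_of_ord (lam i)) (k i) => x y; lia.
  split; last exact/forallP.
  move: sl; rewrite sumnB // -/(absk (fun i => lam i)) -/(absk k).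
  have : (absk k <= absk (fun i => lam i))%N by apply: leq_sum => i _.
  by move: KM; move: (absk (fun i => lam i)) (absk k) => x y; lia.
have leK : (absk k <= absk (fun i => lam i))%N by apply: leq_sum => i _.
split.
  rewrite sumnB // -/(absk (fun i => lam i)) -/(absk k).
  by apply/eqP; move: KM lM leK; move: (absk (fun i => lam i)) (absk k) => x y; lia.
apply/eqP/ffunP => i; apply/val_inj; rewrite /= ffunE hE /= subnK // inordK //.
Qed.

(** Vandermonde with both rows and columns reversed; the two signs are equal and cancel. *)
Lemma det_rev_powers (R : comNzRingType) n (x : 'I_n -> R) :
  \det (\matrix_(i < n, j < n) x i ^+ (n - j.+1)) =
  \prod_(i < n) \prod_(j < n | (i < j)%N) (x i - x j).
Proof.
pose s := perm (@rev_ord_inj n).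
pose V := Vandermonde n (\row_j x (rev_ord j)).
have -> : \matrix_(i < n, j < n) x i ^+ (n - j.+1) = (row_perm s (col_perm s V))^T.
  by apply/matrixP => i j; rewrite !mxE !permE rev_ordK.
rewrite det_tr row_permE col_permE !det_mulmx !det_perm odd_permV mulrC -mulrA -signr_addb addbb mulr1.
rewrite det_Vandermonde (reindex_inj rev_ord_inj) /=.
under eq_bigr => i _ do rewrite (reindex_inj rev_ord_inj) /=.
under eq_bigr => i _ do under eq_bigr => j _ do rewrite !mxE !rev_ordK.
rewrite (exchange_big_dep predT) //=; apply: eq_bigr => i _.
by apply: eq_bigl => j; have := ltn_ord i; have := ltn_ord j; lia.
Qed.

Section Summand.
Variables (F : fieldType) (n M : nat) (q b d t0 : F) (t u : 'I_n -> F).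
Local Notation qp := (qfac q).
Local Notation signq := (signq q).

Hypotheses (q0 : q != 0) (q1 : forall m, q ^+ m.+1 != 1) (b0 : b != 0) (d0 : d != 0).
Hypotheses (t00 : t0 != 0) (tN0 : forall i, t i != 0) (uN0 : forall i, u i != 0).
Hypothesis uu : forall i j, i != j -> forall m l, u i * q ^+ m != u j * q ^+ l.
Hypothesis ut : forall i j m l, u i * q ^+ m != t i * u j * q ^+ l.
Hypothesis t0u : forall i m l, t0 * u i * q ^+ m != q ^+ l.
Hypothesis t0ut : forall i m l, t0 * u i * q ^+ m != t i * q ^+ l.
Hypothesis t0ud : forall i m l, t0 * u i * q ^+ m != d * q ^+ l.
Hypothesis t0udt : forall i m l, t0 * u i * q ^+ m != d * t i * q ^+ l.
Hypothesis t0bd : forall m l, t0 * q ^+ m != b * d * q ^+ l.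
Hypothesis bTt0 : forall m l, b * tprod t * q ^+ m != t0 * q ^+ l.
Hypothesis dq : forall m l, d * q ^+ m != q ^+ l.

Let qm m : q ^+ m != 0. Proof. exact: expf_neq0. Qed.

(** The diagonal is treated by [qfac_rev] and [signq_sqr], the pairs by [qpoch_pair]; the
    [signq (k i)] and the q^{k_i k_j} combine to [signq K]. Each interaction factor on the right has
    k_j only in its base, through u_j q^{k_j}, like a Jackson parameter. *)
Lemma interaction_factor (k : 'I_n -> nat) (K := absk k) :
  (\prod_(i < n) \prod_(j < n)
      (qp (q * u i / (t i * u j)) (k i) / qp (q * u i / u j) (k i)))
  * (\prod_(i < n) \prod_(j < n | (i < j)%N)
      (qpoch (t j * u i / u j) q ((k i)%:Z - (k j)%:Z)
       / qpoch (q * u i / (t i * u j)) q ((k i)%:Z - (k j)%:Z)))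
  * (q ^+ K / q ^+ (\sum_(i < n) i * k i)%N)
  * \prod_(i < n) t i ^+ (i * k i + \sum_(j < n | (i < j)%N) k j)%N
  = signq K * q ^+ K * q ^+ K / \prod_i t i ^+ k i
    * \prod_i \prod_j qp (t j * u i / (u j * q ^+ k j)) (k i)
    / \prod_i \prod_j qp (q * u i / u j) (k i).
Proof.
pose f i j := qp (q * u i / (t i * u j)) (k i).
pose g i j := qp (t j * u i / (u j * q ^+ k j)) (k i).
pose Q i j := qpoch (t j * u i / u j) q ((k i)%:Z - (k j)%:Z)
       / qpoch (q * u i / (t i * u j)) q ((k i)%:Z - (k j)%:Z).
have Eq : q ^+ (\sum_(i < n) i * k i)%N =
    \prod_(i < n) \prod_(j < n | (i < j)%N) q ^+ k j.
  by rewrite prod_ord_lt -prodrXr; apply: eq_bigr => j _; rewrite -exprM mulnC.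
have Et : \prod_(i < n) t i ^+ (i * k i + \sum_(j < n | (i < j)%N) k j)%N =
    \prod_(i < n) \prod_(j < n | (i < j)%N) (t i * t j) ^+ k j.
  under [RHS]eq_bigr => i _ do under eq_bigr => j _ do rewrite exprMn.
  under [RHS]eq_bigr => i _ do rewrite big_split prodrXr.
  rewrite big_split prod_ord_lt -big_split; apply: eq_bigr => i _ /=.
  by rewrite exprD mulrC mulnC exprM.
have Ediag : \prod_i f i i = \prod_i signq (k i) * q ^+ K / \prod_i t i ^+ k i * \prod_i g i i.
  rewrite -prodrXr -prodfV -!big_split; apply: eq_bigr => i _ /=.
  have e0 : t i * u i / (u i * q ^+ k i) = t i / q ^+ k i by field; rewrite uN0 qm.
  rewrite /f /g e0 [qp (t i / _) _]qfac_rev ?mulf_neq0 ?invr_eq0 //.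
  have -> : q * u i / (t i * u i) = q / (t i / q ^+ k i * q ^+ k i).
    by field; rewrite uN0 tN0 qm.
  have := signq_sqr q0 (k i); rewrite expr_div_n exprM.
  move: (signq_neq0 q0 (k i)) (qm (k i)) (tN0 i); move: (signq _) (qp _ _) => s x s0 qk ti E.
  by rewrite -E; field; rewrite s0 qk expf_neq0.
have Epair : \prod_(i < n) \prod_(j < n | (i < j)%N) (f i j * f j i) *
     \prod_(i < n) \prod_(j < n | (i < j)%N) Q i j /
     \prod_(i < n) \prod_(j < n | (i < j)%N) q ^+ k j *
     \prod_(i < n) \prod_(j < n | (i < j)%N) (t i * t j) ^+ k j =
     \prod_(i < n) \prod_(j < n | (i < j)%N) q ^+ (k i * k j) *
     \prod_(i < n) \prod_(j < n | (i < j)%N) (g i j * g j i).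
  rewrite -prodfV -!big_split; apply: eq_bigr => i _ /=.
  rewrite -prodfV -!big_split; apply: eq_bigr => j _ /=.
  rewrite /f /Q qpoch_pair // -/(g i j) -/(g j i) exprM.
  rewrite exprMn exprVn exprS exprMn.
  by field; rewrite !expf_neq0 ?mulf_neq0.
have -> : \prod_(i < n) \prod_(j < n) (qp (q * u i / (t i * u j)) (k i) / qp (q * u i / u j) (k i))
    = \prod_i \prod_j f i j / \prod_i \prod_j qp (q * u i / u j) (k i).
  by rewrite -prodf_div; apply: eq_bigr => i _; rewrite -prodf_div.
rewrite (prod_pairs f) (prod_pairs g) Et Eq Ediag signq_sum.
rewrite [\prod_(i < n) \prod_(j < n | _) (_ / _)](_ : _ =
  \prod_(i < n) \prod_(j < n | (i < j)%N) Q i j) //.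
transitivity (\prod_i signq (k i) * q ^+ K * q ^+ K / \prod_i t i ^+ k i * \prod_i g i i
  / \prod_i \prod_j qp (q * u i / u j) (k i) *
  (\prod_(i < n) \prod_(j < n | (i < j)%N) (f i j * f j i) *
     \prod_(i < n) \prod_(j < n | (i < j)%N) Q i j /
     \prod_(i < n) \prod_(j < n | (i < j)%N) q ^+ k j *
     \prod_(i < n) \prod_(j < n | (i < j)%N) (t i * t j) ^+ k j)).
  by ring.
by rewrite Epair; ring.
Qed.


(* [B], [C] and [z0] are the values for which the Jackson sum with points
   [z0, u_1 q^(k_1), ..., u_n q^(k_n)] and parameters
   [b, C, t_1 / (u_1 q^(k_1)), ..., t_n / (u_n q^(k_n))] is balanced. *)
Let B := t0 * q / d.
Let C := t0 ^+ 2 * q ^+ M.+1 / (b * d * tprod t).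
Let z0 := (t0 * q ^+ M)^-1.

Let T0 : tprod t != 0. Proof. exact/prodf_neq0. Qed.
Let B0 : B != 0. Proof. by rewrite !mulf_neq0 ?invr_eq0. Qed.
Let C0 : C != 0. Proof. by rewrite !mulf_neq0 ?invr_eq0 ?expf_neq0 ?mulf_neq0. Qed.
Let z00 : z0 != 0. Proof. by rewrite invr_eq0 mulf_neq0. Qed.

Lemma div_neq1 (x y : F) : y != 0 -> x != y -> x / y != 1.
Proof. by move=> y0; apply: contra => /eqP E; rewrite -[x](divfK y0) E mul1r. Qed.

Let qpB i m : qp (B * u i) m != 0.
Proof.
apply: qfac_neq0 => s; have := div_neq1 _ (t0ud i s.+1 0).
by rewrite expr0 mulr1 => /(_ d0); congr (_ != _); rewrite exprS /B; ring.
Qed.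

Let qpBq i k m : qp (B * (u i * q ^+ k)) m != 0.
Proof.
apply: qfac_neq0 => s; have := div_neq1 _ (t0ud i (k + s).+1 0).
by rewrite expr0 mulr1 => /(_ d0); congr (_ != _); rewrite exprS exprD /B; ring.
Qed.

Let qpBt i m : qp (B * u i / t i) m != 0.
Proof.
apply: qfac_neq0 => s; have := div_neq1 _ (t0udt i s.+1 0).
rewrite expr0 mulr1 => /(_ (mulf_neq0 d0 (tN0 i))); congr (_ != _).
by rewrite exprS /B; field; rewrite d0 tN0.
Qed.

Let qpBtq i k m : qp (B * (u i * q ^+ k) / t i) m != 0.
Proof.
apply: qfac_neq0 => s; have := div_neq1 _ (t0udt i (k + s).+1 0).
rewrite expr0 mulr1 => /(_ (mulf_neq0 d0 (tN0 i))); congr (_ != _).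
by rewrite exprS exprD /B; field; rewrite d0 tN0.
Qed.

Let qpBb m : qp (B / b) m != 0.
Proof.
apply: qfac_neq0 => s; have := div_neq1 _ (t0bd s.+1 0).
rewrite expr0 mulr1 => /(_ (mulf_neq0 b0 d0)); congr (_ != _).
by rewrite exprS /B; field; rewrite d0 b0.
Qed.

Let qpBC m : qp (B / C) m != 0.
Proof.
apply: qfac_neq0 => s; have := div_neq1 _ (bTt0 s M).
rewrite mulf_neq0 // => /(_ isT); congr (_ != _).
by rewrite /B /C (exprS q M); field; rewrite d0 b0 T0 t00 q0 qm.
Qed.

Let qpBz m : qp (B * z0) m != 0.
Proof.
apply: qfac_neq0 => s; have := div_neq1 _ (dq M s.+1); rewrite qm => /(_ isT).
rewrite -invr_eq1; congr (_ != _).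
by rewrite /B /z0 exprS; field; rewrite d0 t00 q0 !qm.
Qed.

Let qpq m : qp q m != 0.
Proof. by apply: qfac_neq0 => s; rewrite -exprS. Qed.

(** [prod_jackson_ratio] written out for N = M - |k|: factorials of B/x over the parameters x,
    divided by those of B z over the points z. *)
Definition jackson_total (k : 'I_n -> nat) : F :=
  let N := (M - absk k)%N in
  qp (B / b) N * (qp (B / C) N * \prod_i qp (B * (u i * q ^+ k i) / t i) N) /
  (signq N * (qp q N * (qp (B * z0) N * \prod_i qp (B * (u i * q ^+ k i)) N))
   * (z0 * \prod_i (u i * q ^+ k i)) ^+ N).

Lemma jackson_total_neq0 k : jackson_total k != 0.
Proof.
rewrite /jackson_total !mulf_neq0 ?invr_eq0 ?mulf_neq0 ?signq_neq0 ?expf_neq0 ?mulf_neq0 //.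
- by apply/prodf_neq0.
- by apply/prodf_neq0.
- by apply/prodf_neq0 => i _; rewrite mulf_neq0.
Qed.

Definition row_factor i (c : nat) : F :=
  qp (t0 * u i * q / t i) c * qp (b * u i) c * qp (C * u i) c
  / (qp (t0 * u i * q) c * qp (B * u i) c * qp (t0 * u i * q ^+ M.+1 / t i) c)
  / \prod_j qp (q * u i / u j) c.

(** The factorials of length N = M - |k| that [qfac_compl] produces are those of [jackson_total k].
    In what remains, only the determinant and the interaction product mix different indices. *)
Lemma summand_factor (k : 'I_n -> nat) (K := absk k) : (K <= M)%N ->
  summand M q b d t0 t u k =
  \det (\matrix_(i < n, j < n) det_entry q t0 t u k i j) *
  (\prod_(i < n) \prod_(j < n | (i < j)%N) (u i - u j)^-1) *
  (signq M * (z0 * \prod_i u i) ^+ M * (qp (B * z0) M * qp q M / (qp (B / b) M * qp (B / C) M))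
    * \prod_i (qp (B * u i) M / qp (B * u i / t i) M)) *
  jackson_total k * ((q / (z0 * \prod_i u i)) ^+ K *
     (\prod_i \prod_j qp (t j * u i / (u j * q ^+ k j)) (k i) * \prod_i row_factor i (k i))).
Proof.
move=> KM; set N := (M - K)%N.
have HK : qp d K * qp (q ^- M) K / (qp (b * d * q ^- M / t0) K * qp (t0 * q / (b * tprod t)) K)
   = (qp (B * z0) M * qp q M / (qp (B / b) M * qp (B / C) M)) *
     (qp (B / b) N * qp (B / C) N) / (qp (B * z0) N * qp q N) * (tprod t / q) ^+ K.
  (* The four bases take the form q/(a q^M) with a = B z0, q, B/b, B/C, as [qfac_compl] expects. *)
  have e1 : d = q / (B * z0 * q ^+ M) by rewrite /B /z0; field; rewrite d0 q0 t00 !qm.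
  have e2 : q ^- M = q / (q * q ^+ M) by field; rewrite q0 !qm.
  have e3 : b * d * q ^- M / t0 = q / (B / b * q ^+ M) by rewrite /B; field; rewrite d0 b0 q0 t00 !qm.
  have e4 : t0 * q / (b * tprod t) = q / (B / C * q ^+ M).
    by rewrite /B /C (exprS q M); field; rewrite d0 b0 q0 t00 T0 !qm.
  have Bz0N0 : B * z0 != 0 by rewrite mulf_neq0.
  have Bb0 : B / b != 0 by rewrite mulf_neq0 ?invr_eq0.
  have BC0 : B / C != 0 by rewrite mulf_neq0 ?invr_eq0.
  rewrite e3 e4 {1}e1 e2.
  rewrite -(qfac_compl q0 Bz0N0 KM) -(qfac_compl q0 q0 KM).
  rewrite -(qfac_compl q0 Bb0 KM) -(qfac_compl q0 BC0 KM) -/N.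
  have -> : (tprod t / q) ^+ K = (B / b * q ^+ N) ^+ K * (B / C * q ^+ N) ^+ K /
       ((B * z0 * q ^+ N) ^+ K * (q * q ^+ N) ^+ K).
    rewrite -!exprMn -exprVn -exprMn; congr (_ ^+ _).
    by rewrite /B /C /z0 (exprS q M); field; rewrite d0 b0 q0 t00 T0 !qm.
  have nz1 : qp (q / (B / b * q ^+ M)) K != 0.
    by have := qpBb M; rewrite -(qfac_compl q0 Bb0 KM) mulf_eq0 negb_or => /andP[].
  have nz2 : qp (q / (B / C * q ^+ M)) K != 0.
    by have := qpBC M; rewrite -(qfac_compl q0 BC0 KM) mulf_eq0 negb_or => /andP[].
  have nz a : a != 0 -> (a * q ^+ N) ^+ K != 0.
    by move=> a0; rewrite expf_neq0 // mulf_neq0.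
  move: nz1 nz2 (nz _ Bb0) (nz _ BC0) (nz _ Bz0N0) (nz _ q0).
  move: (qpBb N) (qpBC N) (qpBz N) (qpq N) (signq_neq0 q0 K).
  move: ((B / b * q ^+ N) ^+ K) ((B / C * q ^+ N) ^+ K) ((B * z0 * q ^+ N) ^+ K).
  move: ((q * q ^+ N) ^+ K) (qp (q / (B / b * q ^+ M)) K) (qp (q / (B / C * q ^+ M)) K).
  move: (qp (q / (q * q ^+ M)) K) (qp (q / (B * z0 * q ^+ M)) K) (signq K).
  move: (qp (B / b) N) (qp (B / C) N) (qp (B * z0) N) (qp q N).
  move=> x1 x2 x3 x4 x5 x6 x7 x8 x9 x10 x11 x12 x13 h1 h2 h3 h4 h5 h6 h7 h8 h9 h10 h11.
  by field; rewrite ?h1 ?h2 ?h3 ?h4 ?h5 ?h6 ?h7 ?h8 ?h9 ?h10 ?h11.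
have kK i : (k i <= K)%N by rewrite /K /absk (bigD1 i) //= leq_addr.
have HD i : qp (d * q ^- M / (t0 * u i)) (K - k i) / qp (d * t i * q ^- M / (t0 * u i)) (K - k i)
   = qp (B * u i) M / qp (B * u i / t i) M *
     (qp (B * u i / t i) (k i) * qp (B * (u i * q ^+ k i) / t i) N /
      (qp (B * u i) (k i) * qp (B * (u i * q ^+ k i)) N)) * (t i ^+ k i / t i ^+ K).
  have KkM : (K - k i <= M)%N by lia.
  (* The complementary length exceeds N by k_i; the k_i factors split off by [qfacD] are cancelled
     through [HR]. *)
  have eN : (M - (K - k i) = k i + N)%N by have := kK i; rewrite /N; lia.
  have Bu0 : B * u i != 0 by rewrite mulf_neq0.
  have But0 : B * u i / t i != 0 by rewrite mulf_neq0 ?invr_eq0.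
  have e1 : d * q ^- M / (t0 * u i) = q / (B * u i * q ^+ M).
    by rewrite /B; field; rewrite d0 uN0 q0 t00 qm.
  have e2 : d * t i * q ^- M / (t0 * u i) = q / (B * u i / t i * q ^+ M).
    by rewrite /B; field; rewrite d0 uN0 tN0 q0 t00 qm.
  have e3 : B * u i * q ^+ k i = B * (u i * q ^+ k i) by rewrite mulrA.
  have e4 : B * u i / t i * q ^+ k i = B * (u i * q ^+ k i) / t i by ring.
  have nz1 : qp (q / (B * u i / t i * q ^+ M)) (K - k i) != 0.
    by have := qpBt i M; rewrite -(qfac_compl q0 But0 KkM) mulf_eq0 negb_or => /andP[].
  rewrite e1 e2 -(qfac_compl q0 Bu0 KkM) -(qfac_compl q0 But0 KkM) eN !qfacD e3 e4.
  have -> : t i ^+ k i / t i ^+ K = (B * u i / t i * q ^+ (k i + N)) ^+ (K - k i) /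
     (B * u i * q ^+ (k i + N)) ^+ (K - k i).
    rewrite -[in t i ^+ K](subnK (kK i)) exprD invfM mulrCA mulfV ?expf_neq0 // mulr1.
    rewrite -[_^-1]exprVn -exprVn -exprMn; congr (_ ^+ _).
    by field; rewrite B0 uN0 tN0 qm.
  have nz2 : (B * u i * q ^+ (k i + N)) ^+ (K - k i) != 0.
    by rewrite expf_neq0 // mulf_neq0.
  have nz3 : (B * u i / t i * q ^+ (k i + N)) ^+ (K - k i) != 0.
    by rewrite expf_neq0 // mulf_neq0.
  move: nz1 nz2 nz3 (qpBt i (k i)) (qpB i (k i)) (qpBtq i (k i) N) (qpBq i (k i) N) (signq_neq0 q0 (K - k i)).
  move: (qp (B * u i / t i) (k i)) (qp (B * u i) (k i)) (qp (B * (u i * q ^+ k i) / t i) N).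
  move: (qp (B * (u i * q ^+ k i)) N) (signq (K - k i)) (qp (q / (B * u i / t i * q ^+ M)) (K - k i)).
  move: (qp (q / (B * u i * q ^+ M)) (K - k i)) ((B * u i * q ^+ (k i + N)) ^+ (K - k i)).
  move: ((B * u i / t i * q ^+ (k i + N)) ^+ (K - k i)).
  move=> x1 x2 x3 x4 x5 x6 x7 x8 x9 h1 h2 h3 h4 h5 h6 h7 h8.
  by field; rewrite ?h1 ?h2 ?h3 ?h4 ?h5 ?h6 ?h7 ?h8.
(* [row_factor] has (B u_i; q)_{k_i} where the summand has (B u_i/t_i; q)_{k_i}: the former is the
   one that the weight continues to length lambda_i. *)
have HR : \prod_i (qp (t0 * u i * q / t i) (k i) * qp (b * u i) (k i)
       * qp (t0 ^+ 2 * u i * q ^+ M.+1 / (b * d * tprod t)) (k i)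
       / (qp (t0 * u i * q) (k i) * qp (t0 * u i * q / (d * t i)) (k i)
          * qp (t0 * u i * q ^+ M.+1 / t i) (k i))) / \prod_i \prod_j qp (q * u i / u j) (k i)
   = \prod_i row_factor i (k i) *
     (\prod_i qp (B * u i) (k i) / \prod_i qp (B * u i / t i) (k i)).
  rewrite -!prodf_div -big_split; apply: eq_bigr => i _ /=; rewrite /row_factor.
  have -> : t0 ^+ 2 * u i * q ^+ M.+1 / (b * d * tprod t) = C * u i by rewrite /C; ring.
  have -> : t0 * u i * q / (d * t i) = B * u i / t i.
    by rewrite /B; field; rewrite d0 tN0.
  rewrite !invfM; move: (qpB i (k i)); move: (qp (B * u i) _) => x x0.
  move: (qp (t0 * u i * q) _)^-1 (qp (B * u i / _) _)^-1 (qp (t0 * u i * q ^+ _ / _) _)^-1.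
  by move=> y1 y2 y3; move: (\prod_j _)^-1 => y4; field.
have HDP : \prod_i (qp (d * q ^- M / (t0 * u i)) (K - k i) / qp (d * t i * q ^- M / (t0 * u i)) (K - k i))
  = \prod_i (qp (B * u i) M / qp (B * u i / t i) M) *
     (\prod_i qp (B * u i / t i) (k i) * \prod_i qp (B * (u i * q ^+ k i) / t i) N /
      (\prod_i qp (B * u i) (k i) * \prod_i qp (B * (u i * q ^+ k i)) N))
     * (\prod_i t i ^+ k i / tprod t ^+ K).
  rewrite -prodrXl -prodf_div -!big_split -prodf_div -!big_split /=.
  by apply: eq_bigr => i _; rewrite HD.
have HI := interaction_factor k; rewrite -/K /= in HI.
transitivity (\det (\matrix_(i < n, j < n) det_entry q t0 t u k i j) *
  (\prod_(i < n) \prod_(j < n | (i < j)%N) (u i - u j)^-1) *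
  (signq K * q ^+ K * q ^+ K / \prod_i t i ^+ k i
    * \prod_i \prod_j qp (t j * u i / (u j * q ^+ k j)) (k i)
    / \prod_i \prod_j qp (q * u i / u j) (k i)) *
  (qp d K * qp (q ^- M) K / (qp (b * d * q ^- M / t0) K * qp (t0 * q / (b * tprod t)) K)) *
  \prod_i (qp (t0 * u i * q / t i) (k i) * qp (b * u i) (k i)
       * qp (t0 ^+ 2 * u i * q ^+ M.+1 / (b * d * tprod t)) (k i)
       / (qp (t0 * u i * q) (k i) * qp (t0 * u i * q / (d * t i)) (k i)
          * qp (t0 * u i * q ^+ M.+1 / t i) (k i))) *
  \prod_i (qp (d * q ^- M / (t0 * u i)) (K - k i) / qp (d * t i * q ^- M / (t0 * u i)) (K - k i))).
  rewrite -HI; transitivity (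
  (\prod_(i < n) \prod_(j < n)
      (qp (q * u i / (t i * u j)) (k i) / qp (q * u i / u j) (k i)))
  * (\prod_(i < n) \prod_(j < n | (i < j)%N)
      (qpoch (t j * u i / u j) q ((k i)%:Z - (k j)%:Z)
       / qpoch (q * u i / (t i * u j)) q ((k i)%:Z - (k j)%:Z)))
  * (\prod_(i < n) \prod_(j < n | (i < j)%N) (u i - u j)^-1)
  * \det (\matrix_(i < n, j < n) det_entry q t0 t u k i j)
  * (qp d K * qp (q ^- M) K / (qp (b * d * q ^- M / t0) K * qp (t0 * q / (b * tprod t)) K))
  * (\prod_(i < n) (qp (t0 * u i * q / t i) (k i) * qp (b * u i) (k i)
       * qp (t0 ^+ 2 * u i * q ^+ M.+1 / (b * d * tprod t)) (k i)
       / (qp (t0 * u i * q) (k i) * qp (t0 * u i * q / (d * t i)) (k i)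
          * qp (t0 * u i * q ^+ M.+1 / t i) (k i))))
  * (\prod_(i < n) (qp (d * q ^- M / (t0 * u i)) (K - k i)
       / qp (d * t i * q ^- M / (t0 * u i)) (K - k i)))
  * (q ^+ K / q ^+ (\sum_(i < n) i * k i)%N)
  * \prod_(i < n) t i ^+ (i * k i + \sum_(j < n | (i < j)%N) k j)%N); first by [].
  by ring.
transitivity (\det (\matrix_(i < n, j < n) det_entry q t0 t u k i j) *
  (\prod_(i < n) \prod_(j < n | (i < j)%N) (u i - u j)^-1) *
  (signq K * q ^+ K * q ^+ K / \prod_i t i ^+ k i
    * \prod_i \prod_j qp (t j * u i / (u j * q ^+ k j)) (k i)) *
  (qp d K * qp (q ^- M) K / (qp (b * d * q ^- M / t0) K * qp (t0 * q / (b * tprod t)) K)) *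
  (\prod_i (qp (t0 * u i * q / t i) (k i) * qp (b * u i) (k i)
       * qp (t0 ^+ 2 * u i * q ^+ M.+1 / (b * d * tprod t)) (k i)
       / (qp (t0 * u i * q) (k i) * qp (t0 * u i * q / (d * t i)) (k i)
          * qp (t0 * u i * q ^+ M.+1 / t i) (k i))) / \prod_i \prod_j qp (q * u i / u j) (k i)) *
  \prod_i (qp (d * q ^- M / (t0 * u i)) (K - k i) / qp (d * t i * q ^- M / (t0 * u i)) (K - k i))); first by ring.
rewrite HK HDP HR /jackson_total -/K -/N.
(* The q^{KN} from splitting [signq M] cancels the one from the product of the points u_i
   q^{k_i}. *)
have -> : signq M = signq K * signq N * q ^+ (K * N) by rewrite -signqD subnKC.
have -> : (z0 * \prod_i (u i * q ^+ k i)) ^+ N = (z0 * \prod_i u i) ^+ N * q ^+ (K * N).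
  by rewrite big_split prodrXr /= mulrA exprMn exprM.
have -> : (z0 * \prod_i u i) ^+ M = (z0 * \prod_i u i) ^+ K * (z0 * \prod_i u i) ^+ N.
  by rewrite -exprD subnKC.
rewrite !expr_div_n.
have PBk : \prod_i qp (B * u i) (k i) != 0 by apply/prodf_neq0.
have PBtk : \prod_i qp (B * u i / t i) (k i) != 0 by apply/prodf_neq0.
have PBw : \prod_i qp (B * (u i * q ^+ k i)) N != 0 by apply/prodf_neq0.
have Pt : \prod_i t i ^+ k i != 0 by apply/prodf_neq0 => i _; rewrite expf_neq0.
have TK : tprod t ^+ K != 0 by rewrite expf_neq0.
have Z0 : z0 * \prod_i u i != 0 by rewrite mulf_neq0 //; apply/prodf_neq0.
have ZK : (z0 * \prod_i u i) ^+ K != 0 by rewrite expf_neq0.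
have ZN : (z0 * \prod_i u i) ^+ N != 0 by rewrite expf_neq0.
move: PBk PBtk PBw Pt TK ZK ZN (qm K) (qm (K * N)) (signq_neq0 q0 N) (qpBz N) (qpq N) (qpBb M) (qpBC M).
move: ((z0 * \prod_i u i) ^+ K) ((z0 * \prod_i u i) ^+ N) (tprod t ^+ K) => ZK ZN TK.
move: (\prod_i t i ^+ k i) (\prod_i qp (B * (u i * q ^+ k i)) N) => Pt PBw.
move: (\prod_i qp (B * u i / t i) (k i)) (\prod_i qp (B * u i) (k i)) => PBtk PBk.
move: (q ^+ K) (q ^+ (K * N)) (signq K) (signq N) => qK qKN sK sN.
move: (qp (B * z0) N) (qp q N) (qp (B / b) M) (qp (B / C) M) => e1 e2 e3 e4.
move=> h1 h2 h3 h4 h5 h6 h7 h8 h9 h10 h11 h12 h13 h14.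
by field; rewrite ?h1 ?h2 ?h3 ?h4 ?h5 ?h6 ?h7 ?h8 ?h9 ?h10 ?h11 ?h12 ?h13 ?h14.
Qed.

(** * Separation of the indices for fixed lambda *)

Definition level (k : 'I_n -> nat) (o : option 'I_n) : F :=
  if o is Some j then u j * q ^+ k j else z0.

Definition jackson_params (k : 'I_n -> nat) : seq F :=
  b :: C :: [seq t j / (u j * q ^+ k j) | j <- enum 'I_n].

Lemma level_neq k i o' m l : i != o' -> level k i * q ^+ m != level k o' * q ^+ l.
Proof.
have none j p r : u j * q ^+ p != z0 * q ^+ r.
  apply: contraNneq (t0u j (p + M) r) => E; apply/eqP.
  by rewrite exprD -mulrA [u j * _]mulrA E /z0; field; rewrite t00 qm.
case: i o' => [i|] [j|] //= ij; rewrite -?mulrA -?exprD //; last by rewrite eq_sym.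
by rewrite uu //; apply: contra ij => /eqP ->.
Qed.

Lemma jackson_totalE k : (absk k <= M)%N ->
  \sum_(lam : {ffun 'I_n -> 'I_M.+1} |
        (absk (fun i => lam i) <= M)%N && [forall i, k i <= lam i]%N)
     weight q (level k) (jackson_params k) B
       (fun o => if o is Some i then (lam i - k i)%N else (M - absk (fun i => lam i))%N)
  = jackson_total k.
Proof.
move=> KM; rewrite -(@sum_above _ _ _ _ (weight q (level k) (jackson_params k) B)) //; last first.
  by move=> m m' /eq_weight ->.
have w0 j : u j * q ^+ k j != 0 by rewrite mulf_neq0.
rewrite jackson_sum ?leq_subr //.
- rewrite prod_jackson_ratio /jackson_total !big_cons big_map big_enum /= !big_option /=.
  congr (_ * (_ * _) / (_ * _)); apply: eq_bigr => j _; congr (qp _ _).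
  by field; rewrite tN0 uN0 qm.
- by case.
- by move=> i j ij m l; exact: level_neq.
(* Each 1 - B z q^m is the last factor of a nonvanishing factorial of length m + 1. *)
- move=> [j|] m /=; [have := qpBq j (k j) m.+1 | have := qpBz m.+1];
  by rewrite /qfac big_ord_recr /= mulf_eq0 negb_or !mulrA => /andP[].
- move=> x; rewrite !inE => /or3P[/eqP->|/eqP->|/mapP[j _ ->]] //.
  by rewrite mulf_neq0 ?invr_eq0.
- by rewrite /= size_map size_enum_ord card_option card_ord.
(* Balance reduces to b C t_1...t_n z0 = B, which fixes the value of [C]. *)
rewrite !big_cons big_map big_enum big_option /= big_split /= prodfV.
have W0 : \prod_j (u j * q ^+ k j) != 0 by apply/prodf_neq0.
move: W0; move: (\prod_j (u j * q ^+ k j)) => W W0; rewrite -/(tprod t) /B /C /z0 (exprS q M).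
by field; rewrite ?W0 ?b0 ?d0 ?T0 ?q0 ?t00 ?qm.
Qed.

Definition top lam (o : option 'I_n) : F :=
  if o is Some j then u j * q ^+ lam j else z0 * q ^+ (M - absk lam).

Definition top_factor lam : F :=
  qp (b * z0) (M - absk lam) * qp (C * z0) (M - absk lam) / qp (B * z0) (M - absk lam)
  / \prod_o \prod_(s < M - absk lam) (top lam o - z0 * q ^+ s).

(** The top points are [top lam o], independent of k; k survives only in the parameters and in the
    places where the rows start. *)
Lemma weight_factor k lam : (forall i, k i <= lam i)%N ->
  weight q (level k) (jackson_params k) B
       (fun o => if o is Some i then (lam i - k i)%N else (M - absk lam)%N) =
  top_factor lam *
  \prod_i \prod_j qp (t j * u i / (u j * q ^+ k j) * q ^+ k i) (lam i - k i) *
  \prod_j qp (t j * z0 / (u j * q ^+ k j)) (M - absk lam) *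
  \prod_i (qp (b * u i * q ^+ k i) (lam i - k i) * qp (C * u i * q ^+ k i) (lam i - k i)
     / qp (B * u i * q ^+ k i) (lam i - k i)
     / \prod_o \prod_(s < lam i - k i) (top lam o - u i * q ^+ k i * q ^+ s)).
Proof.
move=> kl; rewrite /weight big_option /=.
have topE o : level k o * q ^+ (if o is Some i then (lam i - k i)%N else (M - absk lam)%N) = top lam o.
  by case: o => [j|] //=; rewrite -mulrA -exprD subnKC.
have rowE v m : \prod_(s < m) box_factor (jackson_params k) B (v * q ^+ s) =
   qp (b * v) m * (qp (C * v) m * \prod_j qp (t j / (u j * q ^+ k j) * v) m) / qp (B * v) m.
  rewrite /qfac [\prod_j \prod_(s < m) _]exchange_big -!big_split -prodf_div.
  apply: eq_bigr => s _; rewrite /box_factor !big_cons big_map big_enum /= !mulrA.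
  by congr (_ * _ / _); apply: eq_bigr => j _; rewrite !mulrA.
have boxesE : \prod_o boxes q (level k)
       (fun o => if o is Some i then (lam i - k i)%N else (M - absk lam)%N)
       (level k o * q ^+ (if o is Some i then (lam i - k i)%N else (M - absk lam)%N)) =
    \prod_o \prod_(s < M - absk lam) (top lam o - z0 * q ^+ s) *
    \prod_i \prod_o \prod_(s < lam i - k i) (top lam o - u i * q ^+ k i * q ^+ s).
  rewrite [X in _ = _ * X]exchange_big -big_split; apply: eq_bigr => o _ /=.
  by rewrite topE /boxes big_option.
have e1 i : t i / (u i * q ^+ k i) * z0 = t i * z0 / (u i * q ^+ k i) by rewrite mulrAC.
have e2 i j : t j / (u j * q ^+ k j) * (u i * q ^+ k i) = t j * u i / (u j * q ^+ k j) * q ^+ k i.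
  by rewrite mulrAC !mulrA mulrAC.
rewrite boxesE rowE (eq_bigr _ (fun j _ => congr1 (fun x => qp x _) (e1 j))).
have -> : \prod_i \prod_(s < lam i - k i)
      box_factor (jackson_params k) B (u i * q ^+ k i * q ^+ s) =
    \prod_i qp (b * u i * q ^+ k i) (lam i - k i) * (\prod_i qp (C * u i * q ^+ k i) (lam i - k i)
     * \prod_i \prod_j qp (t j * u i / (u j * q ^+ k j) * q ^+ k i) (lam i - k i))
     / \prod_i qp (B * u i * q ^+ k i) (lam i - k i).
  rewrite -!big_split -prodf_div; apply: eq_bigr => i _ /=.
  rewrite rowE !mulrA; congr (_ * _ / _); apply: eq_bigr => j _.
  by congr (qp _ _); rewrite -e2 mulrA.
rewrite !prodf_div [\prod_i (_ * _)]big_split /= /top_factor invfM.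
by ring.
Qed.

(* All the dependence of [term_factor] on the single index [k_i], besides the determinant. *)
Definition theta lam i (c : nat) : F :=
  (q / (z0 * \prod_j u j)) ^+ c * \prod_j qp (t i * u j / (u i * q ^+ c)) (lam j)
  * qp (t i * z0 / (u i * q ^+ c)) (M - absk lam)
  * \prod_o \prod_(s < c) (top lam o - u i * q ^+ s)
  * (qp (t0 * u i * q / t i) c / (qp (t0 * u i * q) c * qp (t0 * u i * q ^+ M.+1 / t i) c))
  / \prod_j qp (q * u i / u j) c.

Definition vandermonde_norm := \prod_(i < n) \prod_(j < n | (i < j)%N) (u i - u j)^-1.

Definition term_const lam : F :=
  vandermonde_norm *
  (signq M * (z0 * \prod_i u i) ^+ M * (qp (B * z0) M * qp q M / (qp (B / b) M * qp (B / C) M))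
    * \prod_i (qp (B * u i) M / qp (B * u i / t i) M)) *
  top_factor lam *
  \prod_i (qp (b * u i) (lam i) * qp (C * u i) (lam i) / qp (B * u i) (lam i)
     / \prod_o \prod_(s < lam i) (top lam o - u i * q ^+ s)).

Lemma top_neq lam i s o : (s < lam i)%N -> top lam o - u i * q ^+ s != 0.
Proof.
move=> sl; rewrite subr_eq0; case: o => [j|].
  have [->|ji] := eqVneq j i; last by rewrite uu.
  by rewrite /= (inj_eq (mulfI (uN0 i))); apply/eqP => /(expq_inj q0 q1) E; lia.
by have := @level_neq lam None (Some i) (M - absk lam) 0; rewrite /= => H;
  have := @level_neq (fun=> s) None (Some i) (M - absk lam) 0; rewrite /= expr0 mulr1; apply.
Qed.

(** Factors with s < k_i from the summand and with k_i <= s < lambda_i from the weight join to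
    factorials of length lambda_i. For b, C and B these depend on lambda only. In the interaction
    ([E1]) the base keeps the single index k_j, so the factor is assigned to row j by exchanging the
    two products. *)
Lemma term_factor k lam : (absk k <= M)%N -> (forall i, k i <= lam i)%N ->
  summand M q b d t0 t u k / jackson_total k *
  weight q (level k) (jackson_params k) B
       (fun o => if o is Some i then (lam i - k i)%N else (M - absk lam)%N) =
  term_const lam *
  ((\prod_i theta lam i (k i)) * \det (\matrix_(i < n, j < n) det_entry q t0 t u k i j)).
Proof.
move=> KM kl; rewrite summand_factor // weight_factor // -/vandermonde_norm.
have J0 : jackson_total k != 0 by exact: jackson_total_neq0.
have E1 : \prod_i \prod_j qp (t j * u i / (u j * q ^+ k j)) (k i) *
    \prod_i \prod_j qp (t j * u i / (u j * q ^+ k j) * q ^+ k i) (lam i - k i) =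
    \prod_i \prod_j qp (t i * u j / (u i * q ^+ k i)) (lam j).
  rewrite [RHS]exchange_big -big_split; apply: eq_bigr => i _; rewrite -big_split.
  by apply: eq_bigr => j _ /=; rewrite -qfacD subnKC.
pose core i := \prod_o \prod_(s < k i) (top lam o - u i * q ^+ s)
  * (qp (t0 * u i * q / t i) (k i) / (qp (t0 * u i * q) (k i) * qp (t0 * u i * q ^+ M.+1 / t i) (k i)))
  / \prod_j qp (q * u i / u j) (k i).
have E2 : \prod_i row_factor i (k i) *
   \prod_i (qp (b * u i * q ^+ k i) (lam i - k i) *
      qp (C * u i * q ^+ k i) (lam i - k i) /
      qp (B * u i * q ^+ k i) (lam i - k i) /
      \prod_o \prod_(s < lam i - k i) (top lam o - u i * q ^+ k i * q ^+ s)) =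
   \prod_i (qp (b * u i) (lam i) * qp (C * u i) (lam i) / qp (B * u i) (lam i)
     / \prod_o \prod_(s < lam i) (top lam o - u i * q ^+ s)) * \prod_i core i.
  rewrite -!big_split; apply: eq_bigr => i _ /=; rewrite /core /row_factor.
  have -> : \prod_o \prod_(s < lam i) (top lam o - u i * q ^+ s) =
    \prod_o \prod_(s < k i) (top lam o - u i * q ^+ s) *
    \prod_o \prod_(s < lam i - k i) (top lam o - u i * q ^+ k i * q ^+ s).
    rewrite -big_split; apply: eq_bigr => o _ /=.
    rewrite -(big_mkord xpredT (fun s => top lam o - u i * q ^+ s)).
    rewrite (big_cat_nat (n := k i)) //= !big_mkord -[in X in _ * X = _](add0n (k i)) big_addn big_mkord.
    by congr (_ * _); apply: eq_bigr => s _; rewrite exprD -mulrA [q ^+ s * _]mulrC.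
  have split a : qp (a * u i) (lam i) = qp (a * u i) (k i) * qp (a * u i * q ^+ k i) (lam i - k i).
    by rewrite -qfacD subnKC.
  rewrite !split !invfM.
  have G0 : \prod_o \prod_(s < k i) (top lam o - u i * q ^+ s) != 0.
    apply/prodf_neq0 => o _; apply/prodf_neq0 => -[s /= sk] _.
    by apply: top_neq; apply: leq_trans sk (kl i).
  move: G0; move: (\prod_o \prod_(s < k i) _) => G G0.
  move: (\prod_o \prod_(s < lam i - k i) _)^-1 => y1.
  move: (qp (t0 * u i * q) _)^-1 (qp (t0 * u i * q ^+ _ / _) _)^-1 => y2 y3.
  move: (\prod_j qp (q * u i / u j) _)^-1 => y4.
  move: (qp (B * u i * q ^+ k i) _)^-1 (qp (B * u i) _)^-1 => y5 y6.
  by field.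
have E3 : \prod_i theta lam i (k i) = (q / (z0 * \prod_i u i)) ^+ absk k *
    \prod_i \prod_j qp (t i * u j / (u i * q ^+ k i)) (lam j) *
    \prod_i qp (t i * z0 / (u i * q ^+ k i)) (M - absk lam) * \prod_i core i.
  rewrite -prodrXr -!big_split; apply: eq_bigr => i _ /=.
  by rewrite /theta /core; ring.
rewrite E3 /term_const -E1.
move: E2 J0; clear E1 E3.
move: (\prod_i row_factor i (k i)) (jackson_total k) (top_factor lam) vandermonde_norm => w1 J tf V.
move: (\prod_i core i) => w4.
move: (\prod_i (_ / _ / \prod_o \prod_(s < lam i - k i) _)) => w2.
move: (\prod_i (_ / _ / \prod_o \prod_(s < lam i) _)) => w3.
move: ((q / _) ^+ _) (signq M * _ * _ * _) => c1 c2 E2 J0.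
rewrite [RHS](_ : _ = V * c2 * tf * (w3 * w4) * (c1 *
  (\prod_i \prod_j qp (t j * u i / (u j * q ^+ k j)) (k i) *
   \prod_i \prod_j qp (t j * u i / (u j * q ^+ k j) * q ^+ k i) (lam i - k i)) *
   \prod_i qp (t i * z0 / (u i * q ^+ k i)) (M - absk lam) *
  \det (\matrix_(i, j) det_entry q t0 t u k i j))); last by ring.
by rewrite -E2; field.
Qed.

(** * The recurrence behind the telescoping *)

Let r : {poly F} := ('X - (t0^-1)%:P) * \prod_i ('X - (u i)%:P).

Let rE x : r.[x] = (x - t0^-1) * \prod_i (x - u i).
Proof.
rewrite /r !hornerE horner_prod; congr (_ * _); apply: eq_bigr => i _.
by rewrite !hornerE.
Qed.

Lemma r_shift_neq0 i c : r.[u i * q ^+ c.+1] != 0.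
Proof.
rewrite rE mulf_neq0 ?subr_eq0 //.
  apply: contraNneq (t0u i c.+1 0) => E; rewrite -mulrA E expr0 divff //.
apply/prodf_neq0 => j _; rewrite subr_eq0; have [<-|ij] := eqVneq i j.
  by rewrite -[X in _ != X]mulr1 (inj_eq (mulfI (uN0 i))).
by rewrite -[X in _ != X]mulr1 -(expr0 q) uu.
Qed.

Lemma r_shift_div_neq0 i c : r.[u i * q ^+ c.+1 / t i] != 0.
Proof.
rewrite rE mulf_neq0 ?subr_eq0 //.
  apply: contraNneq (t0ut i c.+1 0) => E; apply/eqP; rewrite expr0 mulr1.
  by rewrite -mulrA -[u i * _](divfK (tN0 i)) E mulrA divff // mul1r.
apply/prodf_neq0 => j _; rewrite subr_eq0; apply: contraNneq (ut i j c.+1 0) => E.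
by apply/eqP; rewrite expr0 mulr1 -E mulrCA mulfV // mulr1.
Qed.

(** Put w = u_i q^c. From c to c + 1 the factorials of length lambda_j and M - |lambda| divide by
    p(qw/t_i) and multiply by the qw/t_i - u_j and qw/t_i - z0. The product over boxes gains p(w) up
    to sign, the factor 1 - t_0 qw/t_i completes r(qw/t_i), and r(qw) comes from the denominators.
    The leftover qw/t_i - z0 is cancelled by the factorial with base t_0 u_i q^{M+1}/t_i. *)
Lemma theta_rec lam i c
    (p := ('X - ((t0 * q ^+ (\sum_i lam i))^-1)%:P) * \prod_i ('X - (u i * q ^+ lam i)%:P)) :
    (absk lam <= M)%N -> (c < lam i)%N ->
  theta lam i c.+1 * (p.[u i * q ^+ c.+1 / t i] * r.[u i * q ^+ c.+1]) =
  theta lam i c * (q * p.[u i * q ^+ c] * r.[u i * q ^+ c.+1 / t i]).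
Proof.
move=> LM clam; rewrite -/(absk lam) in p *.
have pE x : p.[x] = (x - z0 * q ^+ (M - absk lam)) * \prod_j (x - u j * q ^+ lam j).
  rewrite /p !hornerE horner_prod; congr (_ * _).
    congr (_ - _); rewrite /z0 -[in q ^+ M](subnK LM) exprD.
    by field; rewrite t00 !qm.
  by apply: eq_bigr => j _; rewrite !hornerE.
(* Raising c by one divides the base by q, which alters only the first and the last factor. *)
have recip a m : qp (a / q) m * (1 - a * q ^+ m / q) = qp a m * (1 - a / q).
  case: m => [|m]; first by rewrite /qfac !big_ord0 expr0 mulr1.
  rewrite /qfac big_ord_recl [in RHS]big_ord_recr /= expr0 mulr1.
  rewrite (eq_bigr (fun s : 'I_m => 1 - a * q ^+ s)) => [|s _].
    have -> : a * q ^+ m.+1 / q = a * q ^+ m by rewrite exprS; field.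
    by ring.
  by rewrite /bump /= add1n exprS; congr (1 - _); field.
set w := u i * q ^+ c.
have w0 : w != 0 by rewrite mulf_neq0.
have eqw : u i * q ^+ c.+1 = q * w by rewrite exprS /w; ring.
rewrite eqw !pE !rE /theta.
have row j : qp (t i * u j / (u i * q ^+ c.+1)) (lam j) * (q * w / t i - u j * q ^+ lam j) =
    qp (t i * u j / (u i * q ^+ c)) (lam j) * (q * w / t i - u j).
  have := recip (t i * u j / w) (lam j); rewrite eqw -/w.
  have -> : t i * u j / w / q = t i * u j / (q * w) by field; rewrite w0 q0.
  have -> : q * w / t i - u j * q ^+ lam j = q * w / t i * (1 - t i * u j / w * q ^+ lam j / q).
    by field; rewrite tN0 w0 q0.
  have -> : q * w / t i - u j = q * w / t i * (1 - t i * u j / (q * w)).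
    by field; rewrite tN0 w0 q0.
  by move=> E; rewrite mulrCA E mulrCA.
have row0 : qp (t i * z0 / (u i * q ^+ c.+1)) (M - absk lam) * (q * w / t i - z0 * q ^+ (M - absk lam)) =
    qp (t i * z0 / (u i * q ^+ c)) (M - absk lam) * (q * w / t i - z0).
  have := recip (t i * z0 / w) (M - absk lam)%N; rewrite eqw -/w.
  have -> : t i * z0 / w / q = t i * z0 / (q * w) by field; rewrite w0 q0.
  have -> : q * w / t i - z0 * q ^+ (M - absk lam) =
      q * w / t i * (1 - t i * z0 / w * q ^+ (M - absk lam) / q).
    by field; rewrite tN0 w0 q0.
  have -> : q * w / t i - z0 = q * w / t i * (1 - t i * z0 / (q * w)).
    by field; rewrite tN0 w0 q0.
  by move=> E; rewrite mulrCA E mulrCA.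
have rowP : \prod_j qp (t i * u j / (u i * q ^+ c.+1)) (lam j) *
      \prod_j (q * w / t i - u j * q ^+ lam j) =
    \prod_j qp (t i * u j / (u i * q ^+ c)) (lam j) * \prod_j (q * w / t i - u j).
  by rewrite -!big_split; apply: eq_bigr => j _; exact: row.
have sgnE (f : 'I_n -> F) x : \prod_j (f j - x) = (-1) ^+ n * \prod_j (x - f j).
  rewrite -[X in _ ^+ X](card_ord n) -prodrN; apply: eq_bigr => j _.
  by rewrite opprB.
have topS : \prod_o \prod_(s < c.+1) (top lam o - u i * q ^+ s) =
    \prod_o \prod_(s < c) (top lam o - u i * q ^+ s) *
    (- (w - z0 * q ^+ (M - absk lam)) * ((-1) ^+ n * \prod_j (w - u j * q ^+ lam j))).
  under eq_bigr => o _ do rewrite big_ord_recr /=.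
  by rewrite big_split; congr (_ * _); rewrite big_option /= -sgnE opprB.
have qpS a m : qp a m.+1 = qp a m * (1 - a * q ^+ m) by rewrite /qfac big_ord_recr.
have colS : \prod_j qp (q * u i / u j) c.+1 = \prod_j qp (q * u i / u j) c *
    ((-1) ^+ n * \prod_j (q * w - u j) / \prod_j u j).
  rewrite -sgnE -prodf_div -big_split; apply: eq_bigr => j _ /=.
  by rewrite qpS /w; congr (_ * _); field; rewrite uN0.
have s1 : t0 * u i * q / t i * q ^+ c = t0 * (q * w / t i) by rewrite /w; ring.
have s2 : t0 * u i * q * q ^+ c = t0 * (q * w) by rewrite /w; ring.
have s3 : t0 * u i * q ^+ M.+1 / t i * q ^+ c = q * w / t i / z0.
  by rewrite /w /z0 invrK exprS; ring.
have a30 : q * w / t i - z0 != 0.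
  rewrite subr_eq0; apply: contraNneq (t0ut i (c.+1 + M) 0) => E; apply/eqP.
  rewrite exprD expr0 mulr1 -mulrA [u i * _]mulrA eqw -[q * w](divfK (tN0 i)) E /z0.
  by field; rewrite t00 qm.
have /andP[a20 PQ0] : (q * w - t0^-1 != 0) && (\prod_j (q * w - u j) != 0).
  by rewrite -negb_or -mulf_eq0 -rE -eqw r_shift_neq0.
have U0 : \prod_j u j != 0 by apply/prodf_neq0.
have sg0 : (-1) ^+ n != 0 :> F by rewrite signr_eq0.
rewrite topS colS !qpS s1 s2 s3 [(q / _) ^+ c.+1]exprSr.
have -> : 1 - t0 * (q * w / t i) = - t0 * (q * w / t i - t0^-1) by field; rewrite t00 tN0.
have -> : 1 - t0 * (q * w) = - t0 * (q * w - t0^-1) by field.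
have -> : 1 - q * w / t i / z0 = - (q * w / t i - z0) / z0 by field; rewrite z00 tN0.
move: rowP row0 a20 PQ0 a30 sg0 U0; clear -t00 z00 q0.
move: ((q / (z0 * \prod_j u j)) ^+ c) => Zc.
move: (\prod_j qp (t i * u j / (u i * q ^+ c.+1)) (lam j)) => P1'.
move: (\prod_j qp (t i * u j / (u i * q ^+ c)) (lam j)) => P1.
move: (qp (t i * z0 / (u i * q ^+ c.+1)) (M - absk lam)) => Q1'.
move: (qp (t i * z0 / (u i * q ^+ c)) (M - absk lam)) => Q1.
move: (\prod_j (q * w / t i - u j * q ^+ lam j)) (\prod_j (q * w / t i - u j)) => PX PU.
move: (\prod_j (q * w - u j)) (\prod_j u j) (\prod_j (w - u j * q ^+ lam j)) => PQ U PW.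
move: (\prod_o \prod_(s < c) (top lam o - u i * q ^+ s)) (qp (t0 * u i * q / t i) c) => G A.
move: (q * w / t i - z0 * q ^+ (M - absk lam)) (q * w / t i - z0) => a4 a3.
move: (q * w / t i - t0^-1) (q * w - t0^-1) (w - z0 * q ^+ (M - absk lam)) => a1 a2 a5.
rewrite !invfM.
move: (qp (t0 * u i * q) c)^-1 (qp (t0 * u i * q ^+ M.+1 / t i) c)^-1 => D E.
move: (\prod_j qp (q * u i / u j) c)^-1 ((-1) ^+ n) => H sg rowP row0 a20 PQ0 a30 sg0 U0.
transitivity ((P1' * PX) * (Q1' * a4) * (q * Zc * G * a5 * PW * A * a1 * D * E * H / a3)).
  by field; rewrite ?oppr_eq0 ?oner_eq0 ?a20 ?PQ0 ?a30 ?sg0 ?U0 ?t00 ?z00.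
by rewrite rowP row0; field; rewrite a30.
Qed.

(** * The term lambda = 0 and the final interchange of sums *)

Lemma term_const0 (lam k : 'I_n -> nat) : lam =1 (fun=> 0%N) -> k =1 (fun=> 0%N) ->
  term_const lam * ((\prod_i theta lam i (k i)) *
    \det (\matrix_(i < n, j < n) det_entry q t0 t u k i j)) = rhs M q b d t0 t u.
Proof.
move=> lam0 k0; have L0 : absk lam = 0%N by rewrite /absk big1.
have -> : \matrix_(i < n, j < n) det_entry q t0 t u k i j =
    \matrix_(i < n, j < n) u i ^+ (n - j.+1).
  apply/matrixP => i j; rewrite !mxE /det_entry k0 expr0 mulr1.
  (* At k = 0 the product over s contains u_i - u_i, so the entry is a pure power and the
     determinant is a Vandermonde determinant. *)
  by rewrite (bigD1 i) //= subrr !mul0r mulr0 subr0 mulr1.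
have -> : \prod_i theta lam i (k i) = \prod_i qp (t i * z0 / u i) M.
  apply: eq_bigr => i _; rewrite /theta k0 L0 subn0 expr0 mulr1 !qfac0.
  by rewrite !big1 => [|j _|o _|j _]; rewrite ?lam0 ?big_ord0 ?qfac0 // !(mulr1, mul1r, divr1).
rewrite det_rev_powers /term_const /top_factor big_option /= L0 subn0.
have -> : \prod_i (qp (b * u i) (lam i) * qp (C * u i) (lam i) / qp (B * u i) (lam i)
     / \prod_o \prod_(s < lam i) (top lam o - u i * q ^+ s)) = 1.
  rewrite big1 // => i _; rewrite lam0 !qfac0 !mul1r invr1 mul1r big1 ?invr1 // => o _.
  by rewrite big_ord0.
have V1 : vandermonde_norm * \prod_(i < n) \prod_(j < n | (i < j)%N) (u i - u j) = 1.
  rewrite -big_split big1 //= => i _; rewrite -big_split big1 //= => j ij.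
  rewrite mulVf // subr_eq0; have := @uu i j _ 0 0; rewrite !mulr1; apply.
  by apply: contraTneq ij => ->; rewrite ltnn.
pose sg := signq M; have sg0 : sg != 0 := signq_neq0 q0 M.
(* Full reversal, the case l = m of [qfac_compl]; it removes the q^{-M} that [z0] puts into the
   bases. *)
have refl a : a != 0 -> qp (q / (a * q ^+ M)) M = qp a M / (a ^+ M * sg).
  move=> a0; rewrite -(qfac_compl q0 a0 (leqnn M)) subnn qfac0 expr0 mulr1 mul1r.
  by rewrite mulfK // mulf_neq0 ?expf_neq0.
have e1 : qp (b * z0) M = qp (t0 * q / b) M / ((t0 * q / b) ^+ M * sg).
  rewrite -refl ?mulf_neq0 ?invr_eq0 //; congr (qp _ _).
  by rewrite /z0; field; rewrite b0 t00 q0 qm.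
have e2 : C * z0 = t0 * q / (b * d * tprod t).
  by rewrite /C /z0 (exprS q M); field; rewrite b0 d0 t00 T0 qm.
have e3 i : qp (t i * z0 / u i) M =
    qp (t0 * u i * q / t i) M / ((t0 * u i * q) ^+ M / t i ^+ M * sg).
  rewrite -expr_div_n -refl ?mulf_neq0 ?invr_eq0 //; congr (qp _ _).
  by rewrite /z0; field; rewrite uN0 tN0 t00 q0 qm.
have e4 j : \prod_(s < M) (u j * q ^+ lam j - z0 * q ^+ s) =
    u j ^+ M * (qp (t0 * u j * q) M / ((t0 * u j * q) ^+ M * sg)).
  rewrite -refl ?mulf_neq0 // -[X in u j ^+ X](card_ord M) -prodr_const -big_split.
  apply: eq_bigr => s _ /=; rewrite lam0 expr0 mulr1 /z0; field.
  by rewrite uN0 t00 q0 qm.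
have e5 : \prod_(s < M) (z0 * q ^+ M - z0 * q ^+ s) = z0 ^+ M * (sg * qp q M).
  have -> : z0 ^+ M * (sg * qp q M) = (z0 * q ^+ M) ^+ M * (qp q M / (q ^+ M * sg)).
    rewrite exprMn -exprM -signq_sqr // -/sg; field; by rewrite qm sg0.
  rewrite -refl // -[X in (z0 * q ^+ M) ^+ X](card_ord M) -prodr_const -big_split.
  by apply: eq_bigr => s _ /=; field; rewrite q0 qm.
have e6 : qp (B / C) M = qp (t0 * q / (b * tprod t)) M *
    (b ^+ M * tprod t ^+ M / (t0 * q) ^+ M / sg).
  have BC0 : B / C != 0 by rewrite mulf_neq0 ?invr_eq0.
  have <- : q / (B / C * q ^+ M) = t0 * q / (b * tprod t).
    by rewrite /B /C (exprS q M); field; rewrite b0 d0 t00 q0 T0 !qm.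
  have -> : b ^+ M * tprod t ^+ M / (t0 * q) ^+ M / sg = (B / C) ^+ M * sg.
    have -> : B / C = b * tprod t / (t0 * q) * (q / q ^+ M).
      by rewrite /B /C (exprS q M); field; rewrite b0 d0 t00 q0 T0 !qm.
    rewrite [(_ * (q / _)) ^+ M]exprMn [(_ / (t0 * q)) ^+ M]expr_div_n [(b * _) ^+ M]exprMn.
    rewrite [(q / _) ^+ M]expr_div_n -exprM -signq_sqr // -/sg.
    by field; rewrite sg0 qm expf_neq0 // mulf_neq0.
  rewrite -(qfac_compl q0 BC0 (leqnn M)) subnn qfac0 expr0 mulr1 -/sg; ring.
have e7 : B / b = t0 * q / (b * d) by rewrite /B; field; rewrite b0 d0.
have e8 i : B * u i = t0 * u i * q / d by rewrite /B; ring.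
have e9 i : B * u i / t i = t0 * u i * q / (d * t i) by rewrite /B; field; rewrite d0 tN0.
have X0 i : qp (t0 * u i * q) M != 0.
  apply: qfac_neq0 => s; have := t0u i s.+1 0; rewrite expr0 exprS; congr (_ != _); ring.
have Y0 i : (t0 * u i * q) ^+ M != 0 by rewrite expf_neq0 ?mulf_neq0.
have ratioE : \prod_i qp (t i * z0 / u i) M /
    \prod_j \prod_(s < M) (u j * q ^+ lam j - z0 * q ^+ s) =
    \prod_i (qp (t0 * u i * q / t i) M / qp (t0 * u i * q) M) *
    (tprod t ^+ M / (\prod_i u i) ^+ M).
  rewrite -!prodrXl -!prodf_div -big_split; apply: eq_bigr => i _ /=.
  rewrite e3 e4; have := Y0 i; have := X0 i; move: sg0.
  move: (qp (t0 * u i * q / t i) M) (qp (t0 * u i * q) M) ((t0 * u i * q) ^+ M) => x1 x2 x3.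
  by move=> h1 h2 h3; field; rewrite h1 h2 h3 !expf_neq0.
have rhsE : rhs M q b d t0 t u =
   qp (t0 * q / b) M * qp (t0 * q / (b * d * tprod t)) M / (qp (B / b) M * qp (t0 * q / (b * tprod t)) M)
   * (\prod_i (qp (t0 * u i * q / t i) M / qp (t0 * u i * q) M)
      * \prod_i (qp (B * u i) M / qp (B * u i / t i) M)).
  rewrite e7 /rhs; congr (_ * _); rewrite -big_split; apply: eq_bigr => i _ /=.
  by rewrite -!/(qfac q _ _) e9 e8 invfM; ring.
rewrite e1 e2 e5 -/sg e6 rhsE; move: ratioE V1.
move: (\prod_i qp (t i * z0 / u i) M) (\prod_j \prod_(s < M) (u j * q ^+ lam j - z0 * q ^+ s)) => P3 P4.
move: (\prod_i (qp (t0 * u i * q / t i) M / _)) (\prod_i (qp (B * u i) M / _)) => RA RB.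
move: vandermonde_norm (\prod_(i < n) \prod_(j < n | _) _) => V D ratioE V1.
have U0 : \prod_i u i != 0 by apply/prodf_neq0.
have BC' : qp (t0 * q / (b * tprod t)) M != 0.
  by have := qpBC M; rewrite e6 mulf_eq0 negb_or => /andP[].
rewrite [(z0 * _) ^+ M]exprMn [(t0 * q / b) ^+ M]expr_div_n.
move: (expf_neq0 M U0) (expf_neq0 M b0) (expf_neq0 M T0) (expf_neq0 M z00) BC' (qpBb M) (qpBz M) (qpq M).
move: (expf_neq0 M (mulf_neq0 t00 q0)) ratioE sg0.
move: ((\prod_i u i) ^+ M) (b ^+ M) (tprod t ^+ M) (z0 ^+ M) ((t0 * q) ^+ M) => UM bM TM zM tM.
move: (qp (t0 * q / (b * tprod t)) M) (qp (B / b) M) (qp (B * z0) M) (qp q M) => x1 x2 x3 x4.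
move: (qp (t0 * q / b) M) (qp (t0 * q / (b * d * tprod t)) M) => x5 x6.
move=> h1 ratioE h2 h3 h4 h5 h6 h7 h8 h9 h10.
rewrite [(_ * P4)^-1]invfM; move: ratioE; move: P4^-1 => P4' ratioE.
transitivity ((V * D) * (P3 * P4') * (sg * (zM * UM) * (x3 * x4 / (x2 *
   (x1 * (bM * TM / tM / sg)))) * RB * (x5 / (tM / bM * sg) * x6 / x3 / (zM * (sg * x4))))).
  by ring.
rewrite V1 ratioE.
by field; rewrite ?h1 ?h2 ?h3 ?h4 ?h5 ?h6 ?h7 ?h8 ?h9 ?h10.
Qed.

Theorem generic_identity : lhs M q b d t0 t u = rhs M q b d t0 t u.
Proof.
rewrite /lhs.
rewrite (eq_bigr (fun k : {ffun 'I_n -> 'I_M.+1} =>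
  \sum_(lam : {ffun 'I_n -> 'I_M.+1} |
        (absk (fun i => lam i) <= M)%N && [forall i, k i <= lam i]%N)
   summand M q b d t0 t u (fun i => k i) / jackson_total (fun i => k i) *
   weight q (level (fun i => k i)) (jackson_params (fun i => k i)) B
       (fun o => if o is Some i then (lam i - k i)%N else (M - absk (fun i => lam i))%N))); last first.
  by move=> k KM; rewrite -mulr_sumr jackson_totalE // divfK // jackson_total_neq0.
rewrite (exchange_big_dep (fun lam : {ffun 'I_n -> 'I_M.+1} => absk (fun i => lam i) <= M)%N) /=; last first.
  by move=> k lam _ /andP[].
rewrite (eq_bigr (fun lam : {ffun 'I_n -> 'I_M.+1} => term_const (fun i => lam i) *
  \sum_(k : {ffun 'I_n -> 'I_M.+1} | k \in family (fun i => [pred c : 'I_M.+1 | (c <= lam i)%N]))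
     (\prod_i theta (fun i => lam i) i (k i)) *
     \det (\matrix_(i, j) det_entry q t0 t u (fun l => k l) i j))); last first.
  (* For fixed lambda, k <= lambda already implies |k| <= M, so k runs over a product of intervals,
     as [inversion] requires. *)
  move=> lam lamM; rewrite mulr_sumr; apply: eq_big => [k|k /and3P[KM _ /forallP kl]].
    rewrite lamM /=; apply/andP/familyP => [[_ /forallP kl i]|kl]; first by rewrite inE kl.
    have kl' i : (k i <= lam i)%N by have := kl i; rewrite inE.
    split; last exact/forallP.
    by apply: leq_trans lamM; apply: leq_sum => i _.
  by rewrite term_factor.
rewrite (bigD1 [ffun=> ord0]) /=; last first.
  by rewrite /absk big1 // => i _; rewrite ffunE.
rewrite [X in _ + X]big1 ?addr0; last first.
  move=> lam /andP[lamM lam0]; rewrite (@inversion _ _ _ _ _ _ M (fun i => lam i)) ?mulr0 //.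
  - by move=> i; rewrite -ltnS.
  - apply/existsP; apply: contraNT lam0 => /existsPn /= lam0.
    by apply/eqP/ffunP => i; apply/val_inj; have := lam0 i; rewrite ffunE /= lt0n negbK => /eqP.
  - exact: r_shift_neq0.
  - exact: r_shift_div_neq0.
  - by move=> i c ci; apply: theta_rec.
rewrite (big_pred1 [ffun=> ord0]); first by rewrite term_const0 // => i; rewrite ffunE.
move=> k; apply/familyP/eqP => [k0|-> i]; last by rewrite inE.
apply/ffunP => i; apply/val_inj; have := k0 i; rewrite inE !ffunE /=.
by rewrite leqn0 => /eqP.
Qed.
End Summand.

(** * Monomials in the indeterminates *)

Section Indeterminates.
Variable n : nat.

Definition mon (m : 'X_{1..nvars n}) : RatFun n := tofrac 'X_[m].

Definition var (a : nat) : 'X_{1..nvars n} := U_(inord a)%MM.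

Lemma monM m1 m2 : mon m1 * mon m2 = mon (m1 + m2)%MM.
Proof. by rewrite /mon mpolyXD tofracM. Qed.

Lemma monXn m c : mon m ^+ c = mon (m *+ c)%MM.
Proof. by rewrite /mon -mpolyXn tofracXn. Qed.

Lemma mon_neq0 m : mon m != 0.
Proof.
rewrite tofrac_eq0; apply/eqP => /(congr1 (fun p => p@_m)).
by rewrite mcoeffX eqxx mcoeff0 => /eqP; rewrite oner_eq0.
Qed.

Lemma mon_neq a (m1 m2 : 'X_{1..nvars n}) : m1 a != m2 a -> mon m1 != mon m2.
Proof.
apply: contra; rewrite tofrac_eq => /eqP /(congr1 (fun p => p@_m1)).
rewrite !mcoeffX eqxx; case: (m2 =P m1) => [->//|_ /eqP].
by rewrite oner_eq0.
Qed.

Lemma varE a c : (a < nvars n)%N -> (c < nvars n)%N ->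
  var a (inord c) = (a == c) :> nat.
Proof.
move=> an cn; rewrite mnm1E; congr (nat_of_bool _).
by apply/eqP/eqP => [/(congr1 val) /=|->//]; rewrite !inordK.
Qed.

End Indeterminates.

Theorem theorem4p1 (n M : nat) :
  lhs M (Xq n) (Xb n) (Xd n) (Xt0 n) (@Xt n) (@Xu n)
  = rhs M (Xq n) (Xb n) (Xd n) (Xt0 n) (@Xt n) (@Xu n).
Proof.
have v0 : (0 < nvars n)%N by [].
have v1 : (1 < nvars n)%N by rewrite /nvars; lia.
have v2 : (2 < nvars n)%N by rewrite /nvars; lia.
have v3 : (3 < nvars n)%N by rewrite /nvars; lia.
have vt (i : 'I_n) : (4 + i < nvars n)%N by have := ltn_ord i; rewrite /nvars; lia.
have vu (i : 'I_n) : (4 + n + i < nvars n)%N by have := ltn_ord i; rewrite /nvars; lia.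
have tprodE : tprod (@Xt n) = mon (\sum_(i < n) var n (4 + i))%MM.
  rewrite /tprod /mon; elim/big_ind2: _ => [|x m1 y m2 -> ->|//].
    by rewrite mpolyX0 tofrac1.
  exact: monM.
(* Each remaining condition compares two monomials and is settled by one variable with different
   exponents. *)
apply: generic_identity; rewrite ?mon_neq0 //.
- move=> m; rewrite -(expr0 (Xq n)) !monXn.
  by apply: (@mon_neq n (inord 0)); rewrite !(mnmDE, mulmnE) varE.
- by move=> i; exact: mon_neq0.
- by move=> i; exact: mon_neq0.
- move=> i j ij m l; rewrite !monXn !monM; apply: (@mon_neq n (inord (4 + n + i))).
  have ij' : (4 + n + j == 4 + n + i)%N = false.
    by rewrite eqn_add2l; apply: contraNF ij => /eqP/val_inj ->.
  by rewrite !(mnmDE, mulmnE) !varE // ij' eqxx.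
(* The exponent of t_i is used: i = j is allowed here, and then u_i is the same on both sides. *)
- move=> i j m l; rewrite !monXn !monM; apply: (@mon_neq n (inord (4 + i))).
  rewrite !(mnmDE, mulmnE) !varE //.
  by move: (ltn_ord i); lia.
- move=> i m l; rewrite !monXn !monM; apply: (@mon_neq n (inord 3)).
  by rewrite !(mnmDE, mulmnE) !varE.
- move=> i m l; rewrite !monXn !monM; apply: (@mon_neq n (inord 3)).
  by rewrite !(mnmDE, mulmnE) !varE.
- move=> i m l; rewrite !monXn !monM; apply: (@mon_neq n (inord 3)).
  by rewrite !(mnmDE, mulmnE) !varE.
- move=> i m l; rewrite !monXn !monM; apply: (@mon_neq n (inord 3)).
  by rewrite !(mnmDE, mulmnE) !varE.
- move=> m l; rewrite !monXn !monM; apply: (@mon_neq n (inord 3)).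
  by rewrite !(mnmDE, mulmnE) !varE.
- move=> m l; rewrite tprodE !monXn !monM; apply: (@mon_neq n (inord 1)).
  by rewrite !(mnmDE, mulmnE) !varE.
- move=> m l; rewrite !monXn !monM; apply: (@mon_neq n (inord 2)).
  by rewrite !(mnmDE, mulmnE) !varE.
Qed.
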